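(* Let $(\mu_k)_{k\ge 1}$ be a sequence of finite positive even compactly supported Borel measures on $\mathbb{R}$, and let $$g_k(z)=\int_{\mathbb{R}} e^{izu}\,d\mu_k(u),\qquad z\in\mathbb{C}.$$ Suppose that $g_k\to G$ locally uniformly on $\mathbb{C}$ and that $G(0)>0$. Then there is a unique finite positive even Borel measure $\mu$ on $\mathbb{R}$ such that $$G(z)=\int_{\mathbb{R}} e^{izu}\,d\mu(u)\qquad\text{for all } z\in\mathbb{C}.$$ Moreover: (i) $\mu_k\to\mu$ weakly as finite measures; (ii) $\mu_k(B)\to\mu(B)$ for every Borel set $B\subset\mathbb{R}$ satisfying $\mu(\partial B)=0$; (iii) $\displaystyle\int_{\mathbb{R}}u^2\,d\mu_k(u)\longrightarrow\int_{\mathbb{R}}u^2\,d\mu(u)=-G''(0)$; (iv) the quadratic tails are uniformly integrable: $\displaystyle\lim_{A\to\infty}\sup_k\int_{|u|>A}u^2\,d\mu_k(u)=0$; (v) for every continuous function $h$ on $\mathbb{R}$ for which there is a constant $C_h$ with $|h(u)|\le C_h(1+u^2)$ for all $u\in\mathbb{R}$, one has $\displaystyle\int_{\mathbb{R}}h\,d\mu_k\longrightarrow\int_{\mathbb{R}}h\,d\mu$; (vi) $\displaystyle\lim_{A\to\infty}\sup_k\mu_k(\{|u|>A\})=0$. Furthermore, $\mu$ has all exponential moments: $\displaystyle\int_{\mathbb{R}}e^{R|u|}\,d\mu(u)<\infty$ for every $R>0$.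
   Context: A measure $\mu$ on $\mathbb{R}$ is even if $\mu(-B)=\mu(B)$ for every Borel set $B$. Weak convergence of finite measures means convergence of integrals of all bounded continuous functions. Locally uniform convergence on $\mathbb{C}$ means uniform convergence on every compact subset of $\mathbb{C}$. *)

(* Defs.v *)
From HB Require Import structures.
From mathcomp Require Import all_boot all_order all_algebra.
From mathcomp Require Import complex.
From mathcomp Require Import all_classical all_reals all_analysis.

Set Implicit Arguments.
Unset Strict Implicit.
Unset Printing Implicit Defensive.

Import Order.TTheory GRing.Theory Num.Theory.
Import numFieldNormedType.Exports.

Local Open Scope complex_scope.
Local Open Scope ring_scope.
Local Open Scope classical_set_scope.

(* [R[i]] gets the topology and norm that every numFieldType carries as a
   normed module over itself, so that [compact], [{uniform K, _ --> _}],
   [derivable] and [derive1n] on [R[i]] are the usual complex notions. *)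
#[warning="-redundant-canonical-projection"]
HB.instance Definition _ (R : rcfType) := NormedModule.copy R[i] R[i]^o.

Section Defs.
Context {R : realType}.
Implicit Types (mu : {finite_measure set R -> \bar R}) (f : R -> R[i]).

(* exp (x + i y) = e^x (cos y + i sin y) *)
Definition cexp (z : R[i]) : R[i] :=
  (expR (complex.Re z))%:C * (cos (complex.Im z) +i* sin (complex.Im z)).

Definition cintegrable mu f : Prop :=
  mu.-integrable setT (EFin \o (fun u => complex.Re (f u))) /\
  mu.-integrable setT (EFin \o (fun u => complex.Im (f u))).

(* [\int[mu]_u] is the real-valued Lebesgue integral [Rintegral] here; it is
   meaningful only under [cintegrable mu f]. *)
Definition cintegral mu f : R[i] :=
  (\int[mu]_u complex.Re (f u)) +i* (\int[mu]_u complex.Im (f u)).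

Definition cexp_kernel (z : R[i]) (u : R) : R[i] :=
  cexp ((0 +i* 1) * z * u%:C).

Definition fourier_laplace mu (z : R[i]) : R[i] :=
  cintegral mu (cexp_kernel z).

(* The absolute convergence that is implicit in writing the integral for every
   complex [z] is part of the representation. *)
Definition represents mu (G : R[i] -> R[i]) : Prop :=
  forall z, cintegrable mu (cexp_kernel z) /\ G z = fourier_laplace mu z.

Definition even_measure mu : Prop :=
  forall B : set R, measurable B -> mu [set - x | x in B] = mu B.

Definition measure_support mu : set R :=
  [set x | forall U : set R, open U -> U x -> (0 < mu U)%E].

Definition compactly_supported mu : Prop := compact (measure_support mu).

Definition weak_cvg (mu_ : nat -> {finite_measure set R -> \bar R}) mu : Prop :=
  forall f : R -> R, continuous f -> bounded_fun f ->
    \int[mu_ k]_u f u @[k --> \oo] --> \int[mu]_u f u.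

Definition locally_uniform_cvg (g_ : nat -> R[i] -> R[i]) (G : R[i] -> R[i]) :
    Prop :=
  forall K : set R[i], compact K -> {uniform K, g_ @ \oo --> G}.

Definition boundary (B : set R) : set R := closure B `\` interior B.

End Defs.

(* Main.v *)
Require Import Defs.
From HB Require Import structures.
From mathcomp Require Import all_boot all_order all_algebra.
From mathcomp Require Import complex ring lra.
From mathcomp Require Import all_classical all_reals all_analysis measurable_realfun.
Import Order.TTheory GRing.Theory Num.Theory.
Import numFieldNormedType.Exports.
Local Open Scope complex_scope.
Local Open Scope ring_scope.
Local Open Scope classical_set_scope.
Set Implicit Arguments.
Unset Strict Implicit.
Unset Printing Implicit Defensive.

(* Convergence of g_k at +ir and -ir bounds the integrals of e^{r|u|} against
   mu_k uniformly in k, for every r. Convergence of g_k on the real line gives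
   convergence of the integrals of trigonometric polynomials; a bounded
   continuous f is on [-M, M] a continuous function of sin (c u), hence close
   to a globally bounded trigonometric polynomial by Weierstrass, and the tails
   are controlled by the exponential moments. So L f = lim \int f dmu_k exists
   for all bounded continuous f. The Stieltjes measure mu of the distribution
   function read off from L on ramps represents L, by piecewise linear
   interpolation. The uniform exponential moments pass to mu and extend the
   convergence to continuous test functions of exponential growth, which yields
   the representation of G, the convergence of second moments and the tail
   estimates. Uniqueness is the same convergence result applied to an
   alternating sequence of two measures with the same transform. *)

(** * Uniform approximation by polynomials *)

(** The line is not compact, so a bounded continuous function need not be a uniform limit of
    trigonometric polynomials. Errors are therefore measured against the weight [expR |u|], whose
    integrals under all [mu_ k] share one bound; this device does the work of tightness. It also
    gives convergence along the whole sequence, with no extraction of subsequences, so the limit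
    functional [L] exists before any measure does. To represent [L], its values on ramps need only
    be squeezed by a distribution function [F]: two functionals squeezed by the same [F] have
    discrepancies on consecutive ramps that add up to at most twice the total mass, while the
    coefficients of these ramps, the increments of [f] between neighbouring nodes, are as small as
    desired. Atoms of the limit thus call for no separate treatment. On the complex side the work is
    done on real functions: the real and imaginary parts of [u ^+ n] times exp (i z u) form one
    family of waves that differ by a phase, and a single Taylor estimate serves both parts and every
    order of differentiation. *)

Section Bernstein.
Context {R : realType}.
Implicit Types (g : nat -> R) (x : R).

(* [(bernstein n g).[x]] is the mean of [g] under the binomial law of
   parameters [n] and [x]; the recursion conditions on the first trial. *)
Fixpoint bernstein (n : nat) (g : nat -> R) : {poly R} :=
  if n is m.+1 then
    (1 - 'X) * bernstein m g + 'X * bernstein m (fun k => g k.+1)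
  else (g 0%N)%:P.

Lemma bernsteinSE n g x : (bernstein n.+1 g).[x] =
  (1 - x) * (bernstein n g).[x] + x * (bernstein n (fun k => g k.+1)).[x].
Proof. by rewrite /= !hornerE. Qed.

Lemma ler_bernstein n g h x : 0 <= x <= 1 -> (forall k, g k <= h k) ->
  (bernstein n g).[x] <= (bernstein n h).[x].
Proof.
move=> /andP[x0 x1]; elim: n g h => [|n IH] g h gh; first by rewrite /= !hornerE.
rewrite !bernsteinSE lerD// ler_wpM2l ?subr_ge0//; apply: IH => //.
Qed.

(** The second moment of a binomial variable about [c] is its variance plus the squared bias. The
    centre [c] is left free because conditioning on a success moves it to [c - 1]. *)
Lemma bernstein_quadratic n (a b c x : R) :
  (bernstein n (fun k => a + b * (k%:R - c) ^+ 2)).[x] =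
  a + b * (n%:R * x * (1 - x) + (n%:R * x - c) ^+ 2).
Proof.
elim: n c => [|n IH] c; first by rewrite /= !hornerE; ring.
rewrite bernsteinSE IH.
have -> : (fun k : nat => a + b * (k.+1%:R - c) ^+ 2) =
          (fun k : nat => a + b * (k%:R - (c - 1)) ^+ 2).
  by apply/funext => k; rewrite -natr1; ring.
by rewrite IH -natr1; ring.
Qed.

(** Compactness, in its near-covering form, merges the local moduli into one. Only [x] is confined
    to the segment, since [f] is continuous on the whole line. *)
Lemma unif_continuous_segment (f : R -> R) (a b e : R) : continuous f -> 0 < e ->
  exists2 d, 0 < d & forall x y, a <= x <= b -> `|x - y| < d -> `|f x - f y| <= e.
Proof.
move=> cf e0.
have /compact_near_coveringP/(_ R (0^'+)
   (fun d x => forall y, `|x - y| < d -> `|f x - f y| <= e) _) := @segment_compact R a b.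
case => [x _|d /= d0 D].
  have e20 : 0 < e / 2 by rewrite divr_gt0.
  have /cvgrPdist_lt /(_ _ e20) [d /= d0 df] := cf x.
  exists (ball x (d / 2), [set z | z < d / 2]) => /=.
    split; first by apply: nbhsx_ballx; rewrite divr_gt0.
    by apply: nbhs_right_lt; rewrite divr_gt0.
  move=> [x' z] /= [xx' zd] y x'y.
  have := df x'; have := df y; rewrite /ball/= in xx' *.
  move=> /(_ _) h1 /(_ _) h2.
  have xx2 : `|x - x'| < d by rewrite (lt_trans xx')// ltr_pdivrMr// ltr_pMr// ltr1n.
  have xy2 : `|x - y| < d.
    rewrite (splitr d) -(subrKA x') (le_lt_trans (ler_normD _ _))//.
    by rewrite ltrD// (lt_trans x'y).
  have := ltrD (h2 xx2) (h1 xy2); rewrite -splitr => /ltW; apply: le_trans.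
  by rewrite -(subrKA (f x)) (le_trans (ler_normD _ _))// lerD2r distrC.
have d20 : 0 < d / 2 by rewrite divr_gt0.
exists (d / 2) => // x y xab.
have /= := D (d / 2); rewrite sub0r normrN gtr0_norm// => /(_ _ d20) => H.
by apply: H => //; rewrite ?ltr_pdivrMr// ?ltr_pMr// ?ltr1n.
Qed.

(** Bernstein's argument: the samples [f (k / n)] are squeezed between two parabolas in [k] centred
    at [n * x], whose binomial means are explicit. *)
Lemma weierstrass01 (f : R -> R) (B e : R) : continuous f ->
    (forall x, `|f x| <= B) -> 0 < e ->
  exists p : {poly R}, forall x, 0 <= x <= 1 -> `|p.[x] - f x| <= e.
Proof.
move=> cf fB e0; have e20 : 0 < e / 2 by rewrite divr_gt0.
have B0 : 0 <= B by apply: le_trans (fB 0).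
have [d d0 fd] := @unif_continuous_segment f 0 1 _ cf e20.
(* With this [K], the term [K * (x - k / n) ^+ 2] reaches [2 * B], the largest possible oscillation
   of [f], once [k / n] is at distance [d] from [x]. *)
pose K := 2 * B / d ^+ 2.
have K0 : 0 <= K by rewrite divr_ge0 ?sqr_ge0 ?mulr_ge0.
pose n := (Num.bound (K / (e / 2))).+1.
have nK : K / n%:R <= e / 2.
  rewrite ler_pdivrMr ?ltr0n// mulrC -ler_pdivrMr//.
  rewrite /n (le_trans (ltW (archi_boundP _)))//; first by rewrite divr_ge0 // ltW.
  by rewrite ler_nat.
have n0 : 0 < n%:R :> R by rewrite ltr0n.
exists (bernstein n (fun k => f (k%:R / n%:R))) => x x01.
have dist k : `|f x - f (k%:R / n%:R)| <= e / 2 + K / n%:R ^+ 2 * (k%:R - n%:R * x) ^+ 2.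
  have [xk|xk] := ltP `|x - k%:R / n%:R| d.
    rewrite (le_trans (fd _ _ x01 xk))// lerDl mulr_ge0 ?sqr_ge0//.
    by rewrite divr_ge0 ?sqr_ge0.
  rewrite (le_trans (ler_normB _ _))// (le_trans (lerD (fB _) (fB _)))//.
  rewrite -[leLHS]add0r lerD ?(ltW e20)//.
  have -> : K / n%:R ^+ 2 * (k%:R - n%:R * x) ^+ 2 =
    (B + B) * ((x - k%:R / n%:R) / d) ^+ 2.
    by rewrite /K; field; rewrite !gt_eqF.
  rewrite ler_peMr ?addr_ge0// -real_normK ?num_real// exprn_ege1//.
  by rewrite normrM normfV (gtr0_norm d0) ler_pdivlMr// mul1r.
have var : K / n%:R ^+ 2 * (n%:R * x * (1 - x) + (n%:R * x - n%:R * x) ^+ 2) <= e / 2.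
  apply: le_trans nK.
  have -> : K / n%:R ^+ 2 * (n%:R * x * (1 - x) + (n%:R * x - n%:R * x) ^+ 2) =
     K / n%:R * (x * (1 - x)) by field; rewrite gt_eqF.
  have Kn0 : 0 <= K / n%:R by rewrite divr_ge0 // ltW.
  by case/andP: x01 => x0 x1; rewrite ler_piMr//; nra.
rewrite ler_distl; apply/andP; split.
- have := @ler_bernstein n
    (fun k => (f x - e / 2) + (- (K / n%:R ^+ 2)) * (k%:R - n%:R * x) ^+ 2)
    (fun k => f (k%:R / n%:R)) x x01.
  rewrite bernstein_quadratic => H.
  apply: le_trans (H _); first by lra.
  by move=> k; have := dist k; rewrite ler_distlC => /andP[]; lra.
- have := @ler_bernstein n (fun k => f (k%:R / n%:R))
    (fun k => (f x + e / 2) + (K / n%:R ^+ 2) * (k%:R - n%:R * x) ^+ 2) x x01.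
  rewrite bernstein_quadratic => H.
  apply: le_trans (H _) _; last by lra.
  by move=> k; have := dist k; rewrite ler_distlC => /andP[]; lra.
Qed.

End Bernstein.

(** * Trigonometric polynomials and bounded continuous functions *)

Section BoundedContinuous.
Context {R : realType}.
Implicit Types (m : {finite_measure set R -> \bar R}) (f g w : R -> R).

Lemma le_dist_Rintegral m f g w (c : R) :
    m.-integrable setT (EFin \o f) -> m.-integrable setT (EFin \o g) ->
    m.-integrable setT (EFin \o w) -> (forall u, `|f u - g u| <= c * w u) ->
  `|\int[m]_u f u - \int[m]_u g u| <= c * \int[m]_u w u.
Proof.
move=> mf mg mw fg; rewrite -RintegralB// -RintegralZl//.
have mfg : m.-integrable setT (EFin \o (fun u => f u - g u)).
  by have := integrableB measurableT mf mg; apply: eq_integrable.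
apply: (le_trans (le_normr_Rintegral _ mfg)) => //.
apply: le_Rintegral => //; first exact: integrable_norm.
by have := integrableZl measurableT c mw; apply: eq_integrable.
Qed.

Lemma integrable_le_continuous m f w : continuous f ->
    m.-integrable setT (EFin \o w) -> (forall u, `|f u| <= w u) ->
  m.-integrable setT (EFin \o f).
Proof.
move=> cf mw fw; apply: le_integrable mw => //.
  by apply/measurable_EFinP; exact: continuous_measurable_fun.
by move=> u _ /=; rewrite lee_fin (le_trans (fw u))// ler_norm.
Qed.

Definition bounded_continuous f :=
  continuous f /\ exists B : R, forall u, `|f u| <= B.

Lemma bounded_continuous_integrable m f :
  bounded_continuous f -> m.-integrable setT (EFin \o f).
Proof.
move=> [cf [B fB]]; apply: (@integrable_le_continuous _ _ (cst B)) => //.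
exact: (finite_measure_integrable_cst m B).
Qed.

Lemma bounded_continuous_cst (a : R) : bounded_continuous (fun=> a).
Proof. by split; [exact: cst_continuous|exists `|a|]. Qed.

Lemma bounded_continuousD f g : bounded_continuous f -> bounded_continuous g ->
  bounded_continuous (fun u => f u + g u).
Proof.
move=> [cf [B fB]] [cg [C gC]]; split.
  by move=> u; apply: cvgD; [exact: cf|exact: cg].
by exists (B + C) => u; rewrite (le_trans (ler_normD _ _))// lerD.
Qed.

Lemma bounded_continuousM f g : bounded_continuous f -> bounded_continuous g ->
  bounded_continuous (fun u => f u * g u).
Proof.
move=> [cf [B fB]] [cg [C gC]]; split.
  by move=> u; apply: cvgM; [exact: cf|exact: cg].
by exists (B * C) => u; rewrite normrM ler_pM.
Qed.

Lemma continuous_affine (t s : R) : continuous (fun u : R => t * u + s).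
Proof.
move=> u; apply: cvgD; last exact: cvg_cst.
by apply: cvgM; [exact: cvg_cst|exact: cvg_id].
Qed.

Lemma bounded_continuous_cos (t s : R) :
  bounded_continuous (fun u => cos (t * u + s)).
Proof.
split; last by exists 1 => u; exact: cos_max.
by move=> u; apply: continuous_comp; [exact: continuous_affine|exact: continuous_cos].
Qed.

Lemma bounded_continuous_sin (t : R) : bounded_continuous (fun u => sin (t * u)).
Proof.
split; last by exists 1 => u; exact: sin_max.
move=> u; apply: continuous_comp; last exact: continuous_sin.
by apply: cvgM; [exact: cvg_cst|exact: cvg_id].
Qed.

End BoundedContinuous.

Section TrigonometricConvergence.
Context {R : realType} (mu_ : nat -> {finite_measure set R -> \bar R}).
Implicit Types (f g : R -> R).

Hypothesis mu_cos : forall t s : R,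
  cvgn (fun k => \int[mu_ k]_u cos (t * u + s)).

(** The cosine factor with arbitrary frequency and phase strengthens the induction: multiplying by
    one more [sin (c * u)] only shifts [t] and [s]. *)
Lemma is_cvg_Rintegral_trig_poly (p : {poly R}) (c : R) :
  bounded_continuous (fun u => p.[(1 + sin (c * u)) / 2]) /\
  forall t s, cvgn (fun k =>
    \int[mu_ k]_u (p.[(1 + sin (c * u)) / 2] * cos (t * u + s))).
Proof.
elim/poly_ind: p => [|p a [bp cp]].
  split.
    have -> : (fun u => 0.[(1 + sin (c * u)) / 2]) = (fun=> 0 : R).
      by apply/funext => u; rewrite horner0.
    exact: bounded_continuous_cst.
  move=> t s.
  under eq_fun do under eq_Rintegral do rewrite horner0 mul0r.
  under eq_fun do rewrite Rintegral_cst//.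
  by under eq_fun do rewrite mul0r; exact: is_cvg_cst.
split.
  have -> : (fun u => (p * 'X + a%:P).[(1 + sin (c * u)) / 2]) =
    (fun u => p.[(1 + sin (c * u)) / 2] * ((1 + sin (c * u)) * 2^-1) + a).
    by apply/funext => u; rewrite hornerD hornerMX hornerC.
  apply: bounded_continuousD (bounded_continuous_cst _).
  apply: bounded_continuousM => //.
  apply: bounded_continuousM (bounded_continuous_cst _).
  exact: bounded_continuousD (bounded_continuous_cst _) (bounded_continuous_sin _).
move=> t s.
pose F t s u := p.[(1 + sin (c * u)) / 2] * cos (t * u + s).
have bF t' s' a' : bounded_continuous (fun u => a' * F t' s' u).
  apply: bounded_continuousM (bounded_continuous_cst _) _.
  exact: bounded_continuousM (bounded_continuous_cos _ _).
(* Product-to-sum formula for sine times cosine, each resulting sine being a cosine with phase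
   [- pi / 2]. *)
have FE u : (p * 'X + a%:P).[(1 + sin (c * u)) / 2] * cos (t * u + s) =
    2^-1 * F t s u + (4^-1 * F (c + t) (s - pi / 2) u +
    (4^-1 * F (c - t) (- s - pi / 2) u + a * cos (t * u + s))).
  rewrite hornerD hornerMX hornerC /F.
  have -> : (c + t) * u + (s - pi / 2) = (c * u + (t * u + s)) - pi / 2 by ring.
  have -> : (c - t) * u + (- s - pi / 2) = (c * u - (t * u + s)) - pi / 2 by ring.
  by rewrite !cosBpihalf sinD sinB; field.
have iF m t' s' a' := @bounded_continuous_integrable R m _ (bF t' s' a').
have bC : bounded_continuous (fun u => a * cos (t * u + s)).
  exact: bounded_continuousM (bounded_continuous_cst _) (bounded_continuous_cos _ _).
have intE k : \int[mu_ k]_u ((p * 'X + a%:P).[(1 + sin (c * u)) / 2] * cos (t * u + s)) =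
    2^-1 * \int[mu_ k]_u F t s u + (4^-1 * \int[mu_ k]_u F (c + t) (s - pi / 2) u +
    (4^-1 * \int[mu_ k]_u F (c - t) (- s - pi / 2) u + a * \int[mu_ k]_u cos (t * u + s))).
  under eq_Rintegral do rewrite FE.
  have iF1 t' s' := @bounded_continuous_integrable R (mu_ k) _
    (bounded_continuousM bp (bounded_continuous_cos t' s')).
  have iC := bounded_continuous_integrable (mu_ k) bC.
  have iD1 := bounded_continuous_integrable (mu_ k)
    (bounded_continuousD (bF (c - t) (- s - pi / 2) 4^-1) bC).
  have iD2 := bounded_continuous_integrable (mu_ k) (bounded_continuousD
    (bF (c + t) (s - pi / 2) 4^-1) (bounded_continuousD (bF (c - t) (- s - pi / 2) 4^-1) bC)).
  rewrite (RintegralD measurableT (iF _ _ _ _) iD2).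
  rewrite (RintegralD measurableT (iF _ _ _ _) iD1).
  rewrite (RintegralD measurableT (iF _ _ _ _) iC).
  rewrite !(RintegralZl _ measurableT (iF1 _ _)) (RintegralZl _ measurableT)//.
  exact: bounded_continuous_integrable (bounded_continuous_cos _ _).
under eq_fun do rewrite intE.
have cM (v : nat -> R) b : cvgn v -> cvgn (fun k => b * v k).
  by move=> cv; apply: is_cvgM => //; exact: is_cvg_cst.
by repeat (apply: is_cvgD; first exact/cM/cp); exact: cM.
Qed.

End TrigonometricConvergence.

Section Clamp.
Context {R : realType}.
Implicit Types (a b u : R).

Definition clamp a b u := Num.max a (Num.min b u).

Lemma continuous_clamp a b : continuous (clamp a b).
Proof.
move=> u; rewrite /clamp.
apply: (@continuous_max _ _ (cst a) (fun u => Num.min b u)); first exact: cst_continuous.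
by apply: (@continuous_min _ _ (cst b) id); [exact: cst_continuous|exact: cvg_id].
Qed.

Lemma clamp_itv a b u : a <= b -> a <= clamp a b u <= b.
Proof. by move=> ab; rewrite le_max lexx ge_max ab ge_min lexx. Qed.

Lemma clamp_id a b u : a <= u <= b -> clamp a b u = u.
Proof. by move=> /andP[au ub]; rewrite /clamp min_r// max_r. Qed.

End Clamp.

(** * Approximation by trigonometric polynomials up to an exponential weight *)

Section TrigonometricApproximation.
Context {R : realType}.
Implicit Types (f : R -> R).

Lemma ler_norm_expR (u : R) : `|u| <= expR `|u|.
Proof. by rewrite (le_trans _ (expR_ge1Dx _))// lerDr. Qed.

(** Strictness keeps clamped arguments in the open interval on which [asin] is continuous. *)
Lemma sin_piquarter_lt1 : sin (pi / 4) < 1 :> R.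
Proof.
have p0 := pi_gt0 R.
by rewrite -[ltRHS]sin_pihalf ltr_sin ?in_itv/=; lra.
Qed.

(** The scale maps [[-M, M]] to [[- pi / 4, pi / 4]], well inside the branch where [asin] inverts
    [sin]. *)
Lemma sin_segment (M u : R) : 0 < M -> `|u| <= M ->
  let s := sin (pi / 4) in - s <= sin (pi / (4 * M) * u) <= s /\
  asin (sin (pi / (4 * M) * u)) = pi / (4 * M) * u.
Proof.
move=> M0 uM s; have p0 := pi_gt0 R.
set v := _ * u.
have : `|v| <= pi / 4.
  have -> : v = pi / 4 * (u / M) by rewrite /v; field; rewrite gt_eqF.
  have p40 : 0 < pi / 4 :> R by rewrite divr_gt0.
  rewrite normrM (gtr0_norm p40) ler_piMr// ?(ltW p40)//.
  by rewrite normrM normfV (gtr0_norm M0) ler_pdivrMr// mul1r.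
rewrite ler_norml => /andP[v1 v2]; split; last by rewrite sinK// in_itv/=; lra.
by rewrite /s -sinN !leNgt !ltr_sin ?in_itv/= -?leNgt ?v1 ?v2//; lra.
Qed.

(* On [-M, M] the map u |-> sin (c u) is injective for c = pi / (4 M), so that
   f is there a continuous function of (1 + sin (c u)) / 2. *)
Lemma trig_poly_approx f (e : R) : bounded_continuous f -> 0 < e ->
  exists (p : {poly R}) (c : R),
    forall u, `|f u - p.[(1 + sin (c * u)) / 2]| <= e * expR (1 * `|u|).
Proof.
move=> [cf [B fB]] e0.
have B0 : 0 <= B by apply: le_trans (fB 0).
(* Chosen so that [e * M = 2 * B + e]: beyond [M] the weight [e * expR |u|] exceeds [e * M], hence
   the crude bound [2 * B + e] on the error. *)
pose M : R := (2 * B + e) / e.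
have M0 : 0 < M by rewrite divr_gt0// ltr_wpDl// mulr_ge0.
pose c := pi / (4 * M); pose s : R := sin (pi / 4).
have c0 : 0 < c by rewrite divr_gt0 ?pi_gt0// mulr_gt0.
have s1 : s < 1 := sin_piquarter_lt1.
have s0 : 0 <= s.
  by have [] := @sin_segment 1 0 ltr01 _; rewrite ?normr0// -/s; lra.
(* Inverts [y = (1 + sin (c * u)) / 2] for [u] in [[-M, M]]; the clamp extends the inverse
   continuously to every real [y]. *)
pose phi (y : R) : R := f (asin (clamp (- s) s (2 * y - 1)) / c).
have phiB y : `|phi y| <= B by exact: fB.
have cclamp : continuous (fun y : R => clamp (- s) s (2 * y - 1)).
  by move=> y; exact: (continuous_comp (@continuous_affine R 2 (-1) y) (@continuous_clamp R _ _ _)).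
have casin : continuous (fun y : R => asin (clamp (- s) s (2 * y - 1)) / c).
  move=> y; apply: cvgM; last exact: cvg_cst.
  have s1y : -1 < clamp (- s) s (2 * y - 1) < 1.
    by have := @clamp_itv _ (- s) s (2 * y - 1); lra.
  exact: (continuous_comp (cclamp y) (continuous_asin s1y)).
have cphi : continuous phi by move=> y; exact: (continuous_comp (casin y) (cf _)).
have [p pP] := weierstrass01 cphi phiB e0.
exists p, c => u.
pose y := (1 + sin (c * u)) / 2.
have y01 : 0 <= y <= 1.
  by have := sin_geN1 (c * u); have := sin_le1 (c * u); rewrite /y; lra.
have := pP _ y01; rewrite distrC -/y => py.
rewrite mul1r.
have [uM|uM] := leP `|u| M.
  have [sc ac] := sin_segment M0 uM.
  have -> : f u = phi y.
    rewrite /phi /y; have -> : 2 * ((1 + sin (c * u)) / 2) - 1 = sin (c * u) by field.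
    by rewrite clamp_id// ac mulrC mulKf// gt_eqF.
  rewrite (le_trans py)// ler_peMr// ?(ltW e0)//.
  by rewrite (le_trans _ (expR_ge1Dx _))// lerDl.
rewrite -(subrKA (phi y)) (le_trans (ler_normD _ _))//.
have : `|f u - phi y| <= 2 * B.
  by rewrite (le_trans (ler_normB _ _))// mulr2n mulrDl mul1r lerD.
have : 2 * B + e = e * M by rewrite /M; field; rewrite gt_eqF.
have := ler_norm_expR u => h1 h2 h3.
have : e * M <= e * expR `|u| by rewrite ler_pM2l// (le_trans (ltW uM)).
lra.
Qed.

End TrigonometricApproximation.

Definition exp_integrable {R : realType} (m : {finite_measure set R -> \bar R}) :=
  forall r : R, m.-integrable setT (EFin \o (fun u => expR (r * `|u|))).

(** To be read together with [exp_integrable]: without it the real-valued integral could be a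
    default value. *)
Definition exp_bounded {R : realType} (mu_ : nat -> {finite_measure set R -> \bar R}) :=
  forall r : R, exists K, forall k, \int[mu_ k]_u expR (r * `|u|) <= K.

Section BoundedContinuousConvergence.
Context {R : realType} (mu_ : nat -> {finite_measure set R -> \bar R}).
Implicit Types (f g : R -> R).
Hypothesis mu_int : forall k, exp_integrable (mu_ k).
Hypothesis mu_bnd : exp_bounded mu_.
Hypothesis mu_cos : forall t s : R, cvgn (fun k => \int[mu_ k]_u cos (t * u + s)).

(** Convergent sequences are closed in the sup norm: the limit of an approximant is the centre of a
    ball of radius [e] that eventually contains [v], which gives the Cauchy property. *)
Lemma is_cvgn_approx (v : nat -> R) :
  (forall e : R, 0 < e -> exists2 a : nat -> R, cvgn a & forall k, `|v k - a k| <= e) ->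
  cvgn v.
Proof.
move=> va; apply/cauchy_cvgP; apply: cauchy_exP => e e0.
have e30 : 0 < e / 3 by rewrite divr_gt0.
have [a /cvgrPdist_lt /(_ _ e30) ca vaE] := va _ e30.
exists (limn a).
have : \forall k \near \oo, ball (limn a) e (v k); last by [].
apply: filterS ca => k h1; rewrite /ball/=.
rewrite -(subrKA (a k)) (le_lt_trans (ler_normD _ _))//.
by have := vaE k; rewrite distrC => h2; lra.
Qed.

Lemma is_cvg_Rintegral_bounded_continuous f : bounded_continuous f ->
  cvgn (fun k => \int[mu_ k]_u f u).
Proof.
move=> bf; apply: is_cvgn_approx => e e0.
have [K KP] := mu_bnd 1.
have K0 : 0 <= K by apply: le_trans (KP 0%N); apply: Rintegral_ge0 => u _; exact: expR_ge0.
(* The weight has integral at most [K] under every [mu_ k], so the error stays below [e]; the [+ 1]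
   covers [K = 0]. *)
have [|p [c pc]] := @trig_poly_approx _ f (e / (K + 1)) bf.
  by rewrite divr_gt0// ltr_wpDl.
have [bp cp] := is_cvg_Rintegral_trig_poly mu_cos p c.
exists (fun k => \int[mu_ k]_u p.[(1 + sin (c * u)) / 2]).
  have := cp 0 0; under eq_fun do under eq_Rintegral do rewrite mul0r addr0 cos0 mulr1.
  by [].
move=> k.
have := le_dist_Rintegral (bounded_continuous_integrable (mu_ k) bf)
  (bounded_continuous_integrable _ bp) (mu_int k 1) pc.
move/le_trans; apply.
rewrite (@le_trans _ _ (e / (K + 1) * K))//.
  by rewrite ler_wpM2l// divr_ge0 ?addr_ge0// ltW.
rewrite mulrAC ler_pdivrMr; last by rewrite ltr_wpDl.
by rewrite ler_pM2l// lerDl.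
Qed.

End BoundedContinuousConvergence.

(** * A measure representing the limit functional *)

Section FiniteMeasures.
Context {R : realType}.

Lemma finite_measure_of_additive (f : set R -> \bar R) :
    f set0 = 0%E -> (forall A, (0 <= f A)%E) -> semi_sigma_additive f ->
    (f setT < +oo)%E ->
  exists m : {finite_measure set R -> \bar R}, forall A, m A = f A.
Proof.
move=> f0 f_ge0 f_add fT.
pose fM := isMeasure.Build default_measure_display R R f f0 f_ge0 f_add.
pose fP : {measure set R -> \bar R} := HB.pack f fM.
have f_fin : fin_num_fun fP by exact: lty_fin_num_fun.
pose fF : {finite_measure set R -> \bar R} :=
  HB.pack f fM (Measure_isFinite.Build _ _ _ fP f_fin).
by exists fF.
Qed.

Lemma lebesgue_stieltjes_measure_itv (f : cumulative R R) a b : a <= b ->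
  lebesgue_stieltjes_measure f `]a, b]%classic = (f b - f a)%:E.
Proof.
move=> ab; rewrite /lebesgue_stieltjes_measure /measure_extension/=.
rewrite measurable_mu_extE/=; last exact: is_ocitv.
by rewrite wlength_itv_bnd// EFinB.
Qed.

(** Continuity from below along []-n, x]] and then []-oo, n]] turns the increments of [F] into its
    values and the total mass, and the latter gives finiteness. *)
Lemma finite_measure_of_cdf (F : R -> R) (l : R) : nondecreasing F ->
    lebesgue_stieltjes_measure.right_continuous F -> F @ -oo --> (0 : R) -> F @ +oo --> l ->
  exists nu : {finite_measure set R -> \bar R},
    (forall x, nu `]-oo, x]%classic = (F x)%:E) /\ nu setT = l%:E.
Proof.
move=> nd rc FNy Fy.
pose Fc : cumulative R R := HB.pack F (isCumulative.Build R _ R F nd rc).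
pose lsf := lebesgue_stieltjes_measure Fc.
have lsfE a b : a <= b -> lsf `]a, b]%classic = (F b - F a)%:E.
  exact: (@lebesgue_stieltjes_measure_itv Fc).
have cdfE x : lsf `]-oo, x]%classic = (F x)%:E.
  rewrite itvNybndEbigcup.
  have : lsf `]-n%:R, x] @[n --> \oo] --> (F x)%:E.
    suff : ((F x)%:E - (F (-n%:R))%:E)%E @[n --> \oo] --> (F x)%:E.
      apply: cvg_trans; apply: near_eq_cvg; near=> n.
      rewrite lsfE -?EFinB//.
      by rewrite lerNl; near: n; exact: nbhs_infty_ger.
    rewrite -[X in _ --> X](sube0 (F x)%:E); apply: (cvgeB _ (cvg_cst _ )) => //.
    apply: (cvg_comp _ _ (cvg_comp _ _ _ FNy)) => //.
    by apply: (cvg_comp _ _ cvgr_idn); rewrite ninfty.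
  have : lsf `]-n%:R, x] @[n --> \oo] --> lsf (\bigcup_n `]-n%:R, x]%classic).
    apply: nondecreasing_cvg_mu => //; first exact: bigcup_measurable.
    by move=> *; apply/subsetPset/subset_itv; rewrite leBSide//= lerN2 ler_nat.
  exact: cvg_unique.
have lsfT : lsf setT = l%:E.
  have -> : [set: R] = \bigcup_n `]-oo, n%:R]%classic.
    apply/esym; rewrite -subTset => x _; exists (Num.bound `|x|) => //=.
    by rewrite in_itv/= (le_trans (ler_norm x))// ltW// archi_boundP.
  have : lsf `]-oo, n%:R] @[n --> \oo] --> l%:E.
    under eq_fun do rewrite cdfE.
    apply/cvg_EFin; first by near=> n.
    exact: (cvg_comp _ _ (@cvgr_idn R) Fy).
  have : lsf `]-oo, n%:R] @[n --> \oo] --> lsf (\bigcup_n `]-oo, n%:R]%classic).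
    apply: nondecreasing_cvg_mu => //; first exact: bigcup_measurable.
    by move=> i j ij; apply/subsetPset/subset_itvl; rewrite bnd_simp ler_nat.
  exact: cvg_unique.
have [|nu nuE] := finite_measure_of_additive (f := lsf) (measure0 lsf)
  (fun A => measure_ge0 lsf A)
  (@measure_semi_sigma_additive _ (measurableTypeR R) R lsf).
  by rewrite lsfT ltry.
by exists nu; split => [x|]; rewrite nuE.
Unshelve. all: by end_near. Qed.

End FiniteMeasures.

(** * Ramps and piecewise linear interpolation *)

Section Ramp.
Context {R : realType}.
Implicit Types (a b u : R) (f g : R -> R).

(** For [a < b], a continuous substitute for the indicator of a left half-line: it lies between
    those of []-oo, a]] and []-oo, b]]. *)
Definition ramp a b u := clamp 0 1 ((b - u) / (b - a)).

Lemma ramp_itv a b u : 0 <= ramp a b u <= 1.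
Proof. exact: clamp_itv. Qed.

Lemma ramp_eq1 a b u : a < b -> u <= a -> ramp a b u = 1.
Proof.
move=> ab ua; rewrite /ramp /clamp min_l ?max_r//.
by rewrite ler_pdivlMr ?subr_gt0// mul1r lerB.
Qed.

Lemma ramp_eq0 a b u : a < b -> b <= u -> ramp a b u = 0.
Proof.
move=> ab ua; rewrite /ramp /clamp max_l// ge_min; apply/orP; right.
by rewrite pmulr_lle0 ?invr_gt0 ?subr_gt0// subr_le0.
Qed.

Lemma bounded_continuous_ramp a b : bounded_continuous (ramp a b).
Proof.
split; last first.
  by exists 1 => u; have /andP[r0 r1] := ramp_itv a b u; rewrite ger0_norm.
have cr : continuous (fun u => (b - u) / (b - a)).
  move=> u; apply: cvgM; last exact: cvg_cst.
  by apply: cvgB; [exact: cvg_cst|exact: cvg_id].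
by move=> u; exact: (continuous_comp (cr u) (@continuous_clamp R 0 1 _)).
Qed.

Lemma ler_ramp a b c d u : a < b -> c < d -> b <= c -> ramp a b u <= ramp c d u.
Proof.
move=> ab cd bc; have /andP[r0 r1] := ramp_itv c d u.
have /andP[s0 s1] := ramp_itv a b u.
have [ub|bu] := leP u b; first by rewrite (@ramp_eq1 c d)// (le_trans ub).
by rewrite ramp_eq0// ltW.
Qed.

(* The piecewise linear interpolation of [f] at the nodes [x 0 < ... < x n],
   constant outside of [x 0, x n], after summation by parts. *)
Fixpoint interpolation f (x : nat -> R) n : R -> R :=
  if n is m.+1 then fun u => interpolation f x m u + (f (x m.+1) - f (x m)) +
    (f (x m) - f (x m.+1)) * ramp (x m) (x m.+1) u
  else cst (f (x 0%N)).

Lemma bounded_continuous_interpolation f x n :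
  bounded_continuous (interpolation f x n).
Proof.
elim: n => [|n IH] /=; first exact: bounded_continuous_cst.
apply: bounded_continuousD.
  exact: bounded_continuousD IH (bounded_continuous_cst _).
exact: bounded_continuousM (bounded_continuous_cst _) (bounded_continuous_ramp _ _).
Qed.

Section interpolation_values.
Variables (f : R -> R) (x : nat -> R) (e : R).
Hypothesis x_incr : forall j, x j < x j.+1.

Let x_homo i j : (i <= j)%N -> x i <= x j.
Proof.
by move=> /subnKC <-; elim: (j - i)%N => [|k IH]; rewrite ?addn0// addnS (le_trans IH)// ltW.
Qed.

Lemma interpolation_right n u : x n <= u -> interpolation f x n u = f (x n).
Proof.
elim: n => //= n IH xu; rewrite IH ?(le_trans (ltW (x_incr n)))//.
by rewrite ramp_eq0//; ring.
Qed.

Lemma interpolation_left n u : u <= x 0%N -> interpolation f x n u = f (x 0%N).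
Proof.
by elim: n => //= n IH xu; rewrite IH// ramp_eq1 ?(le_trans xu (x_homo _))//; ring.
Qed.

Lemma interpolation_approx n u :
  (forall j (v : R), (j < n)%N -> x j <= v <= x j.+1 ->
    `|f v - f (x j)| <= e /\ `|f v - f (x j.+1)| <= e) ->
  0 <= e -> x 0%N <= u <= x n -> `|f u - interpolation f x n u| <= e.
Proof.
move=> + e0; elim: n => [|n IH] fe /andP[x0u uxn].
  by rewrite (@interpolation_right 0)// (@le_anti _ _ u (x 0%N)) ?subrr ?normr0// x0u uxn.
have [uxn'|xnu] := leP u (x n).
  have -> : interpolation f x n.+1 u = interpolation f x n u.
    by rewrite /= ramp_eq1//; ring.
  by apply: IH => [j v jn|]; [apply: fe; rewrite (ltn_trans jn)|rewrite x0u].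
rewrite /= interpolation_right ?(ltW xnu)//.
have [||h1 h2] := fe n u => //; first by rewrite (ltW xnu).
set rho := ramp _ _ _.
have /andP[r0 r1] : 0 <= rho <= 1 := ramp_itv _ _ _.
(* Between two nodes the interpolant is the convex combination of the nodal values with weights
   [rho] and [1 - rho]. *)
have -> : f u - (f (x n) + (f (x n.+1) - f (x n)) + (f (x n) - f (x n.+1)) * rho) =
  rho * (f u - f (x n)) + (1 - rho) * (f u - f (x n.+1)) by ring.
rewrite (le_trans (ler_normD _ _))// !normrM (ger0_norm r0).
have r1' : 0 <= 1 - rho by rewrite subr_ge0.
rewrite (ger0_norm r1').
have -> : e = rho * e + (1 - rho) * e by ring.
by rewrite lerD// ler_wpM2l.
Qed.

End interpolation_values.
End Ramp.

(** * Functionals determined by a distribution function *)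

Section CdfFunctional.
Context {R : realType}.
Implicit Types (f g w : R -> R).

(* Through the squeeze on ramps, [F] determines a positive linear functional on
   the bounded continuous functions; both a limit of integrals and the integral
   against a measure are functionals of this kind. *)
Definition cdf_functional (F : R -> R) (l : R) (L : (R -> R) -> R) :=
  [/\ forall f g c, bounded_continuous f -> bounded_continuous g ->
        L (fun u => f u + c * g u) = L f + c * L g,
      forall f g, bounded_continuous f -> bounded_continuous g ->
        (forall u, f u <= g u) -> L f <= L g,
      L (fun=> 1) = l &
      forall c a b, c < a -> a < b -> F c <= L (ramp a b) <= F b].

Lemma cdf_functional_cst F l L (c : R) : cdf_functional F l L -> L (fun=> c) = c * l.
Proof.
move=> [lin _ L1 _]; have b1 := @bounded_continuous_cst R 1.
have := lin _ _ (c - 1) b1 b1; rewrite L1.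
rewrite (_ : (fun _ => _) = fun=> c); last by apply/funext => u; ring.
by move=> ->; ring.
Qed.

Lemma cdf_functional_dist F l L f g w : cdf_functional F l L ->
    bounded_continuous f -> bounded_continuous g -> bounded_continuous w ->
  (forall u, `|f u - g u| <= w u) -> `|L f - L g| <= L w.
Proof.
move=> [lin mono _ _] bf bg bw fg.
have bD h k : bounded_continuous h -> bounded_continuous k ->
    bounded_continuous (fun u => h u + 1 * k u).
  move=> bh bk; apply: bounded_continuousD => //.
  by apply: bounded_continuousM => //; exact: bounded_continuous_cst.
have h1 : L f <= L g + 1 * L w.
  rewrite -lin//; apply: mono => //; first exact: bD.
  by move=> u; have := fg u; rewrite ler_distl => /andP[]; lra.
have h2 : L g <= L f + 1 * L w.
  rewrite -lin//; apply: mono => //; first exact: bD.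
  by move=> u; have := fg u; rewrite ler_distl => /andP[]; lra.
by rewrite ler_distl; apply/andP; split; lra.
Qed.

(** On the ramp from [x j] to [x j.+1] both functionals lie between [F (x j - h)] and [F (x j.+1)];
    the shift by [h] supplies the strict inequality that the squeeze asks for. Each gap spans two
    steps, so the sum telescopes to two values of [F] at either end, a bound independent of [n].
    Constants cancel because the masses agree. *)
Lemma cdf_functional_interpolation F l L1 L2 f (x : nat -> R) (e h : R) n :
    cdf_functional F l L1 -> cdf_functional F l L2 -> 0 < h ->
    (forall j, x j.+1 = x j + h) -> (forall j, (j < n)%N -> `|f (x j) - f (x j.+1)| <= e) ->
  `|L1 (interpolation f x n) - L2 (interpolation f x n)| <=
  e * (F (x n) + F (x n - h) - (F (x 0%N) + F (x 0%N - h))).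
Proof.
move=> H1 H2 h0 xS; elim: n => [|n IH] fe.
  by rewrite /= !(cdf_functional_cst _ H1) !(cdf_functional_cst _ H2) !subrr normr0 mulr0.
have step L : cdf_functional F l L -> L (interpolation f x n.+1) =
    L (interpolation f x n) + (f (x n.+1) - f (x n)) * l +
    (f (x n) - f (x n.+1)) * L (ramp (x n) (x n.+1)).
  move=> H; have [lin _ L1l _] := H; rewrite /=.
  have bi := bounded_continuous_interpolation f x n.
  rewrite lin; first last.
  - exact: bounded_continuous_ramp.
  - exact: bounded_continuousD bi (bounded_continuous_cst _).
  congr (_ + _); have := lin _ _ (f (x n.+1) - f (x n)) bi (bounded_continuous_cst 1).
  by under [in X in X = _ -> _]eq_fun do rewrite mulr1; rewrite L1l.
rewrite !step//.
have xx : x n < x n.+1 by rewrite xS ltrDl.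
have xh : x n - h < x n by rewrite ltrBlDr ltrDl.
have [_ _ _ /(_ _ _ _ xh xx)/andP[a1 b1]] := H1.
have [_ _ _ /(_ _ _ _ xh xx)/andP[a2 b2]] := H2.
set I1 := L1 (ramp _ _) in a1 b1 *; set I2 := L2 (ramp _ _) in a2 b2 *.
have -> : L1 (interpolation f x n) + (f (x n.+1) - f (x n)) * l +
  (f (x n) - f (x n.+1)) * I1 - (L2 (interpolation f x n) + (f (x n.+1) - f (x n)) * l +
  (f (x n) - f (x n.+1)) * I2) = (L1 (interpolation f x n) - L2 (interpolation f x n)) +
  (f (x n) - f (x n.+1)) * (I1 - I2) by ring.
rewrite (le_trans (ler_normD _ _))//.
have fen := fe n (ltnSn n).
have -> : e * (F (x n.+1) + F (x n.+1 - h) - (F (x 0%N) + F (x 0%N - h))) =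
  e * (F (x n) + F (x n - h) - (F (x 0%N) + F (x 0%N - h))) + e * (F (x n.+1) - F (x n - h)).
  have -> : x n.+1 - h = x n by rewrite xS addrK.
  ring.
rewrite lerD ?IH//; first by move=> j jn; apply: fe; exact: ltnW.
rewrite normrM ler_pM// ler_distl; lra.
Qed.

Lemma cdf_functional_unique F l L1 L2 f :
    (forall x, 0 <= F x <= l) -> F @ -oo --> (0 : R) -> F @ +oo --> l ->
    cdf_functional F l L1 -> cdf_functional F l L2 -> bounded_continuous f ->
  L1 f = L2 f.
Proof.
move=> Fl FNy Fy H1 H2 bf; have [cf [B fB]] := bf.
have B0 : 0 <= B by apply: le_trans (fB 0).
have l0 : 0 <= l by have /andP[F0 Fl0] := Fl 0; exact: le_trans Fl0.
(* Replacing [f] by its interpolant costs [e * (l + 4 * B)] under each functional, and the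
   interpolant itself contributes [e * (2 * l)]. *)
suff : forall e : R, 0 < e -> `|L1 f - L2 f| <= e * (4 * l + 8 * B).
  move=> H; apply/eqP; rewrite -subr_eq0 -normr_le0 leNgt; apply/negP => d0.
  have C0 : 0 < 4 * l + 8 * B + 1 by lra.
  have := H (`|L1 f - L2 f| / 2 / (4 * l + 8 * B + 1)).
  rewrite !divr_gt0// => /(_ isT).
  rewrite mulrAC ler_pdivlMr//; nra.
move=> e e0.
(* The cut-off ramps start at [M - 1] and end at [1 - M]; [M - 2] lies strictly to the left of the
   former, as the lower bound by [F] requires. *)
have [M [M0 FM FMN]] : exists M : R, [/\ 1 < M, l - e <= F (M - 2) & F (1 - M) <= e].
  have le_l : l - e < l by rewrite ltrBlDr ltrDl.
  have [A [_ hA]] : \forall y \near +oo, l - e <= F y := cvgr_ge _ Fy _ le_l.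
  have [A' [_ hA']] : \forall y \near -oo, F y <= e := cvgr_le _ FNy _ e0.
  have := ler_norm A; have := ler_norm (- A'); rewrite normrN => ? ?.
  have := normr_ge0 A; have := normr_ge0 A' => ? ?.
  by exists (3 + `|A| + `|A'|); split; [lra|apply: hA; lra|apply: hA'; lra].
have NMM : - M < M by lra.
have [d d0 fd] := @unif_continuous_segment _ f (- M) M _ cf e0.
pose n := (Num.bound (2 * M / d)).+1.
pose h : R := 2 * M / n%:R.
have n0 : 0 < n%:R :> R by rewrite ltr0n.
have h0 : 0 < h by rewrite divr_gt0//; lra.
have hd : h < d.
  have Md0 : 0 <= 2 * M / d by rewrite divr_ge0 ?(ltW d0)//; lra.
  rewrite /h ltr_pdivrMr// [d * _]mulrC -ltr_pdivrMr//.
  by rewrite (lt_le_trans (archi_boundP Md0))// ler_nat.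
pose x (j : nat) : R := - M + h * j%:R.
have xS j : x j.+1 = x j + h by rewrite /x -natr1; ring.
have xI j : x j < x j.+1 by rewrite xS ltrDl.
have x0 : x 0%N = - M by rewrite /x mulr0 addr0.
have xn : x n = M by rewrite /x /h; field; rewrite gt_eqF.
have xj j : (j <= n)%N -> - M <= x j <= M.
  move=> jn; rewrite -{2}xn /x lerDl lerD2l ler_wpM2l ?ler_nat// ?(ltW h0)//.
  by rewrite mulr_ge0// ltW.
pose g := interpolation f x n.
have bg : bounded_continuous g := bounded_continuous_interpolation _ _ _.
have fe j (v : R) : (j < n)%N -> x j <= v <= x j.+1 ->
    `|f v - f (x j)| <= e /\ `|f v - f (x j.+1)| <= e.
  move=> jn /andP[v1 v2]; have /andP[a1 a2] := xj _ (ltnW jn).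
  have /andP[b1 b2] := xj _ jn.
  have vM : - M <= v <= M by rewrite (le_trans a1)// (le_trans v2).
  split; apply: fd => //; rewrite ltr_distl; have := xS j; lra.
(* That is, [e] plus [2 * B] times a cut-off equal to 1 left of [- M], plus [2 * B] times one equal
   to 1 right of [M]. *)
pose w u := (e + 2 * B) + (2 * B) * ramp (- M) (1 - M) u + (- (2 * B)) * ramp (M - 1) M u.
have bc1 : bounded_continuous (fun u => (e + 2 * B) + (2 * B) * ramp (- M) (1 - M) u).
  apply: bounded_continuousD; first exact: bounded_continuous_cst.
  exact: bounded_continuousM (bounded_continuous_cst _) (bounded_continuous_ramp _ _).
have bw : bounded_continuous w.
  apply: bounded_continuousD => //.
  exact: bounded_continuousM (bounded_continuous_cst _) (bounded_continuous_ramp _ _).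
have fgB u v : `|f u - f v| <= 2 * B.
  by rewrite (le_trans (ler_normB _ _))// mulr2n mulrDl mul1r lerD.
have fgw u : `|f u - g u| <= w u.
  have /andP[r0 r1] := ramp_itv (- M) (1 - M) u.
  have /andP[s0 s1] := ramp_itv (M - 1) M u.
  have := fgB u.
  have [uM|Mu] := leP u (- M).
    move=> /(_ (- M)); rewrite /g interpolation_left ?x0// /w.
    rewrite (@ramp_eq1 _ _ (1 - M)) //; last by lra.
    by nra.
  have [Mu'|uM] := leP M u.
    move=> /(_ M); rewrite /g interpolation_right ?xn// /w (@ramp_eq0 _ (M - 1)) //; last by lra.
    by nra.
  move=> _; apply: (@le_trans _ _ e); last by rewrite /w; nra.
  by apply: interpolation_approx => //; rewrite ?x0 ?xn ?ltW.
have Lw L : cdf_functional F l L -> L w <= e * (l + 4 * B).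
  move=> H; have [lin mono Ll Fs] := H.
  rewrite /w lin//; last exact: bounded_continuous_ramp.
  rewrite lin; [|exact: bounded_continuous_cst|exact: bounded_continuous_ramp].
  rewrite (cdf_functional_cst _ H).
  have /andP[a1 a2] : F (- M - 1) <= L (ramp (- M) (1 - M)) <= F (1 - M) by apply: Fs; lra.
  have /andP[b1 b2] : F (M - 2) <= L (ramp (M - 1) M) <= F M by apply: Fs; lra.
  by nra.
have gg : `|L1 g - L2 g| <= e * (2 * l).
  have H : forall j, (j < n)%N -> `|f (x j) - f (x j.+1)| <= e.
    by move=> j jn; have [] := fe j (x j) jn _; rewrite ?lexx ?(ltW (xI j)).
  apply: (le_trans (cdf_functional_interpolation H1 H2 h0 xS H)).
  rewrite ler_pM2l//; have := Fl (x n); have := Fl (x n - h).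
  by have := Fl (x 0%N); have := Fl (x 0%N - h); lra.
have := le_trans (cdf_functional_dist H1 bf bg bw fgw) (Lw _ H1).
have := le_trans (cdf_functional_dist H2 bf bg bw fgw) (Lw _ H2).
move: gg; rewrite !ler_norml => /andP[? ?] /andP[? ?] /andP[? ?].
by apply/andP; split; lra.
Qed.

End CdfFunctional.

(** * The distribution function of the limit functional *)

Section LimitMeasure.
Context {R : realType} (mu_ : nat -> {finite_measure set R -> \bar R}).
Implicit Types (f g : R -> R).
Hypothesis mu_int : forall k, exp_integrable (mu_ k).
Hypothesis mu_bnd : exp_bounded mu_.
Hypothesis mu_cvg : forall f, bounded_continuous f -> cvgn (fun k => \int[mu_ k]_u f u).

Let L f : R := limn (fun k => \int[mu_ k]_u f u).

Let L_lin f g c : bounded_continuous f -> bounded_continuous g ->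
  L (fun u => f u + c * g u) = L f + c * L g.
Proof.
move=> bf bg; apply/cvg_lim => //.
have bcg : bounded_continuous (fun u => c * g u).
  by apply: bounded_continuousM => //; exact: bounded_continuous_cst.
have E k : \int[mu_ k]_u (f u + c * g u) = \int[mu_ k]_u f u + c * \int[mu_ k]_u g u.
  rewrite RintegralD//; try exact: bounded_continuous_integrable.
  by rewrite RintegralZl//; exact: bounded_continuous_integrable.
under eq_fun do rewrite E.
by apply: cvgD; [exact: mu_cvg|apply: cvgM; [exact: cvg_cst|exact: mu_cvg]].
Qed.

Let L_mono f g : bounded_continuous f -> bounded_continuous g ->
  (forall u, f u <= g u) -> L f <= L g.
Proof.
move=> bf bg fg; apply: ler_lim; [exact: mu_cvg|exact: mu_cvg|].
by apply: nearW => k; apply: le_Rintegral => //; exact: bounded_continuous_integrable.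
Qed.

(** Tightness in functional form: with [c = M^-1] it makes [L] small on functions with values in
    [[0, 1]] that vanish for [|u| < M]. *)
Let L_exp : exists2 K, 0 <= K & forall f c, bounded_continuous f -> 0 <= c ->
  (forall u, f u <= c * expR `|u|) -> L f <= c * K.
Proof.
have [K KP] := mu_bnd 1.
exists K; first by apply: le_trans (KP 0%N); apply: Rintegral_ge0 => u _; exact: expR_ge0.
move=> f c bf c0 fc; apply: limr_le; first exact: mu_cvg.
apply: nearW => k; apply: (@le_trans _ _ (c * \int[mu_ k]_u expR (1 * `|u|))).
  rewrite -RintegralZl//; last exact: mu_int.
  apply: le_Rintegral => //; first exact: bounded_continuous_integrable.
    by have := integrableZl measurableT c (mu_int k 1); apply: eq_integrable.
  by move=> u _; rewrite mul1r.
by rewrite ler_wpM2l.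
Qed.

Let l := L (fun=> 1).

(* Only ramps strictly to the right of [x], so that [F] is right-continuous. *)
Let ramps x : set R := [set y | exists a b, [/\ x < a, a < b & y = L (ramp a b)]].

Let F x := inf (ramps x).

Let ramp_ge0 a b : 0 <= L (ramp a b).
Proof.
apply: limr_ge; first exact/mu_cvg/bounded_continuous_ramp.
apply: nearW => k; apply: Rintegral_ge0 => u _.
by have /andP[] := ramp_itv a b u.
Qed.

Let ramp_le a b : L (ramp a b) <= l.
Proof.
apply: L_mono; [exact: bounded_continuous_ramp|exact: bounded_continuous_cst|].
by move=> u; have /andP[] := ramp_itv a b u.
Qed.

Let ramps_neq0 x : ramps x !=set0.
Proof.
by exists (L (ramp (x + 1) (x + 2))), (x + 1), (x + 2); split=> //; lra.
Qed.

Let F_le c a b : c < a -> a < b -> F c <= L (ramp a b).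
Proof.
move=> ca ab; apply: ge_inf; last by exists a, b.
by exists 0 => _ [a' [b' [_ _ ->]]].
Qed.

Let F_ge a b x : a < b -> b <= x -> L (ramp a b) <= F x.
Proof.
move=> ab bx; apply: lb_le_inf => // _ [c [d [xc cd ->]]].
apply: L_mono; [exact: bounded_continuous_ramp|exact: bounded_continuous_ramp|].
by move=> u; apply: ler_ramp => //; rewrite (le_trans bx)// ltW.
Qed.

Let F_itv x : 0 <= F x <= l.
Proof.
apply/andP; split; first by apply: lb_le_inf => // _ [c [d [xc cd ->]]].
by apply: (@le_trans _ _ (L (ramp (x + 1) (x + 2)))) => //; apply: F_le; lra.
Qed.

Let F_nd : nondecreasing F.
Proof.
move=> x y xy; apply: lb_le_inf => // _ [c [d [xc cd ->]]].
by apply: F_le => //; exact: le_lt_trans xc.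
Qed.

Let F_rc : lebesgue_stieltjes_measure.right_continuous F.
Proof.
move=> x; apply/cvgrPdist_le => e e0.
(* A ramp that nearly attains the infimum at [x] starts at some [a > x], hence competes in the
   infimum at every [y < a]. *)
have [|_ [a [b [xa ab ->]]] Le] := @inf_adherent _ (ramps x) _ e0.
  by split => //; exists 0 => _ [a' [b' [_ _ ->]]].
near=> y.
have xy : x < y by near: y; exact: nbhs_right_gt.
have ya : y < a by near: y; exact: nbhs_right_lt.
rewrite distrC ger0_norm ?subr_ge0 ?F_nd ?ltW//.
rewrite ltrBlDl (le_lt_trans _ Le)// F_le//.
Unshelve. all: by end_near. Qed.

Let F_Ny : F @ -oo --> (0 : R).
Proof.
have [K K0 KP] := L_exp.
apply/cvgrPdist_le => e e0; near=> x.
have /andP[Fx0 Fxl] := F_itv x.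
rewrite sub0r normrN ger0_norm//.
(* Where the ramp is nonzero, [1 <= |u| / M <= expR |u| / M], so its value under [L] is at most
   [K / M], which is below [e]. *)
pose M := K / e + 1.
have Ke : 0 <= K / e by rewrite divr_ge0// ltW.
have M0 : 0 < M by rewrite /M; lra.
have xM : x < - M - 1 by near: x; apply: nbhs_ninfty_lt; exact: num_real.
apply: (@le_trans _ _ (L (ramp (- M - 1) (- M)))); first by apply: F_le => //; lra.
apply: (@le_trans _ _ (M^-1 * K)).
  apply: KP; [exact: bounded_continuous_ramp|by rewrite invr_ge0 ltW|move=> u].
  have [uM|Mu] := ltP u (- M); last first.
    rewrite ramp_eq0//; first by rewrite mulr_ge0 ?expR_ge0// invr_ge0 ltW.
    by lra.
  have /andP[_ r1] := ramp_itv (- M - 1) (- M) u.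
  rewrite (le_trans r1)// mulrC ler_pdivlMr// mul1r.
  rewrite (le_trans _ (ler_norm_expR u))//.
  by have := ler_norm (- u); rewrite normrN; lra.
rewrite mulrC ler_pdivrMr// /M mulrDr mulr1 mulrC divfK ?gt_eqF//.
by rewrite lerDl ltW.
Unshelve. all: by end_near. Qed.

Let F_y : F @ +oo --> l.
Proof.
have [K K0 KP] := L_exp.
apply/cvgrPdist_le => e e0; near=> x.
have /andP[Fx0 Fxl] := F_itv x.
rewrite ger0_norm ?subr_ge0//.
pose M := K / e + 1.
have Ke : 0 <= K / e by rewrite divr_ge0// ltW.
have M0 : 0 < M by rewrite /M; lra.
have xM : M + 1 < x by near: x; apply: nbhs_pinfty_gt; exact: num_real.
have bM := @bounded_continuous_ramp R M (M + 1).
apply: (@le_trans _ _ (l - L (ramp M (M + 1)))).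
  by rewrite lerD2l lerN2; apply: F_ge; lra.
have -> : l - L (ramp M (M + 1)) = L (fun u => 1 + (- 1) * ramp M (M + 1) u).
  by rewrite L_lin//; [rewrite mulN1r|exact: bounded_continuous_cst].
apply: (@le_trans _ _ (M^-1 * K)).
  apply: KP; [|by rewrite invr_ge0 ltW|move=> u].
    apply: bounded_continuousD; first exact: bounded_continuous_cst.
    by apply: bounded_continuousM => //; exact: bounded_continuous_cst.
  have [uM|Mu] := leP u M.
    rewrite ramp_eq1//; last by lra.
    by rewrite mulr1 subrr mulr_ge0 ?expR_ge0// invr_ge0 ltW.
  have /andP[r0 _] := ramp_itv M (M + 1) u.
  apply: (@le_trans _ _ 1); first by lra.
  rewrite mulrC ler_pdivlMr// mul1r.
  rewrite (le_trans _ (ler_norm_expR u))//.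
  by have := ler_norm u; lra.
rewrite mulrC ler_pdivrMr// /M mulrDr mulr1 mulrC divfK ?gt_eqF//.
by rewrite lerDl ltW.
Unshelve. all: by end_near. Qed.

Lemma ex_weak_limit : exists mu : {finite_measure set R -> \bar R},
  forall f, bounded_continuous f -> \int[mu_ k]_u f u @[k --> \oo] --> \int[mu]_u f u.
Proof.
have [nu [nuF nuT]] := finite_measure_of_cdf F_nd F_rc F_Ny F_y.
have LP : cdf_functional F l L.
  split => // c a b ca ab; rewrite F_le//= F_ge//.
have nuP : cdf_functional F l (fun f => \int[nu]_u f u).
  split.
  - move=> f g c bf bg.
    have bcg : bounded_continuous (fun u => c * g u).
      by apply: bounded_continuousM => //; exact: bounded_continuous_cst.
    rewrite RintegralD//; try exact: bounded_continuous_integrable.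
    by rewrite RintegralZl//; exact: bounded_continuous_integrable.
  - by move=> f g bf bg fg; apply: le_Rintegral => //; exact: bounded_continuous_integrable.
  - by rewrite Rintegral_cst//= nuT mul1r.
  - move=> c a b ca ab.
    have nuI x : F x = \int[nu]_u \1_(`]-oo, x]%classic : set R) u.
      rewrite /Rintegral integral_indic// setIT. by rewrite -[F x]/(fine (F x)%:E) -nuF.
    have iI (x : R) : nu.-integrable setT (EFin \o \1_(`]-oo, x]%classic : set R)).
      by apply: integrable_indic.
    have ir := bounded_continuous_integrable nu (@bounded_continuous_ramp _ a b).
    apply/andP; split.
      rewrite (le_trans (F_nd (ltW ca)))// nuI; apply: le_Rintegral => // u _.
      rewrite indicE; case: (boolP (u \in _)) => [|_]; last by have /andP[] := ramp_itv a b u.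
      by rewrite inE/= in_itv/= => ua; rewrite ramp_eq1.
    rewrite nuI; apply: le_Rintegral => // u _.
    rewrite indicE; case: (boolP (u \in _)) => [_|]; first by have /andP[] := ramp_itv a b u.
    by rewrite notin_setE/= in_itv/= => /negP; rewrite -ltNge => bu; rewrite ramp_eq0// ltW.
exists nu => f bf.
rewrite -(cdf_functional_unique F_itv F_Ny F_y LP nuP bf).
exact: mu_cvg.
Qed.

End LimitMeasure.

(** * Test functions of exponential growth *)

Section ExponentialGrowth.
Context {R : realType} (mu_ : nat -> {finite_measure set R -> \bar R})
  (mu : {finite_measure set R -> \bar R}).
Implicit Types (f g : R -> R).
Hypothesis mu_int : forall k, exp_integrable (mu_ k).
Hypothesis mu_bnd : exp_bounded mu_.
Hypothesis mu_weak : forall f, bounded_continuous f ->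
  \int[mu_ k]_u f u @[k --> \oo] --> \int[mu]_u f u.

Lemma continuous_expR_norm (r : R) : continuous (fun u : R => expR (r * `|u|)).
Proof.
move=> u; apply: (@continuous_comp _ _ _ (fun u : R => r * `|u|) expR); last exact: continuous_expR.
by apply: cvgM; [exact: cvg_cst|exact: norm_continuous].
Qed.

(** The truncations at height [n] are bounded and continuous, so they inherit the uniform bound in
    the weak limit; monotone convergence then removes the truncation. *)
Lemma integral_expR_le (r : R) : exists K : R,
  (\int[mu]_u (expR (r * `|u|))%:E <= K%:E)%E.
Proof.
have [K KP] := mu_bnd r; exists K.
pose fn (n : nat) (u : R) : R := Num.min n%:R (expR (r * `|u|)).
have bfn n : bounded_continuous (fn n).
  split; last first.
    exists n%:R => u; rewrite ger0_norm; first by rewrite ge_min lexx.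
    by rewrite le_min ler0n expR_ge0.
  move=> u; rewrite /fn.
  apply: (@continuous_min _ _ (cst n%:R) (fun u : R => expR (r * `|u|))).
    exact: cst_continuous.
  exact: continuous_expR_norm.
have fnK n : (\int[mu]_u (fn n u)%:E <= K%:E)%E.
  rewrite -(fineK (integrable_fin_num measurableT (bounded_continuous_integrable mu (bfn n)))).
  rewrite lee_fin -/(Rintegral mu setT (fn n)).
  have <- : limn (fun k => \int[mu_ k]_u fn n u) = \int[mu]_u fn n u.
    by apply/cvg_lim => //; exact: mu_weak.
  apply: limr_le; first by apply/cvg_ex; exists (\int[mu]_u fn n u); exact: mu_weak.
  apply: nearW => k; apply: le_trans (KP k); apply: le_Rintegral => //.
  - exact: bounded_continuous_integrable.
  - exact: mu_int.
  by move=> u _; rewrite /fn ge_min lexx orbT.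
have fnE u : limn (fun n => (fn n u)%:E) = (expR (r * `|u|))%:E.
  apply/cvg_lim => //; apply: cvg_near_cst.
  near=> n; rewrite /fn min_r//.
  by near: n; exact: nbhs_infty_ger.
have mfn n : measurable_fun setT (fn n) := continuous_measurable_fun (bfn n).1.
have fn_cvg : (\int[mu]_u (fn n u)%:E)%E @[n --> \oo] -->
    (\int[mu]_u (limn (fun n => (fn n u)%:E)))%E.
  apply: cvg_monotone_convergence => //.
  - by move=> n; apply/measurable_EFinP; exact: mfn.
  - by move=> n u _; rewrite lee_fin le_min ler0n expR_ge0.
  - by move=> u _ m n mn; rewrite lee_fin /fn le_min !ge_min ler_nat mn lexx orbT.
under eq_integral do rewrite -fnE.
rewrite -(cvg_lim _ fn_cvg)//; apply: lime_le; last exact: nearW.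
by apply/cvg_ex; eexists; exact: fn_cvg.
Unshelve. all: by end_near. Qed.

Lemma exp_integrable_limit : exp_integrable mu.
Proof.
move=> r; have [K KP] := integral_expR_le r; apply/integrableP; split.
  by apply/measurable_EFinP; exact: (continuous_measurable_fun (@continuous_expR_norm r)).
rewrite (le_lt_trans _ (ltry K))//; apply: le_trans KP.
by under eq_integral do rewrite /= ger0_norm ?expR_ge0//.
Qed.

(** Clamping the argument to [[-M, M]] makes [f] bounded and alters it only where [|u| > M]. There
    [1 <= expR |u| / M], so raising the exponent from [r] to [r + 1] gains a factor [M^-1]. *)
Lemma cvg_Rintegral_exp_growth f (C r : R) : 0 <= r -> continuous f ->
    (forall u, `|f u| <= C * expR (r * `|u|)) ->
  \int[mu_ k]_u f u @[k --> \oo] --> \int[mu]_u f u.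
Proof.
move=> r0 cf fC.
have C0 : 0 <= C.
  have := fC 0; rewrite normr0 mulr0 expR0 mulr1; exact: le_trans.
have iw : exp_integrable mu := exp_integrable_limit.
have if_ m : exp_integrable m -> m.-integrable setT (EFin \o f).
  move=> im; apply: (@integrable_le_continuous _ _ _ (fun u => C * expR (r * `|u|))) => //.
  by have := integrableZl measurableT C (im r); apply: eq_integrable.
pose fM (M : R) u := f (clamp (- M) M u).
have bfM M : 0 < M -> bounded_continuous (fM M).
  move=> M0; split.
    by move=> u; exact: (continuous_comp (@continuous_clamp R (- M) M u) (cf _)).
  exists (C * expR (r * M)) => u; rewrite (le_trans (fC _))// ler_wpM2l// ler_expR.
  by rewrite ler_wpM2l// ler_norml clamp_itv//; lra.
have fMd M u : 0 < M -> `|f u - fM M u| <= (2 * C / M) * expR ((r + 1) * `|u|).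
  move=> M0; rewrite /fM.
  have [uM|Mu] := leP `|u| M.
    rewrite clamp_id; last by rewrite -ler_norml.
    by rewrite subrr normr0 mulr_ge0 ?expR_ge0// divr_ge0 ?(ltW M0)// mulr_ge0.
  have h : expR (r * `|clamp (- M) M u|) <= expR (r * `|u|).
    rewrite ler_expR ler_wpM2l// (le_trans _ (ltW Mu))// ler_norml clamp_itv//; lra.
  rewrite (le_trans (ler_normB _ _))// (le_trans (lerD (fC _) (fC _)))//.
  have -> : expR ((r + 1) * `|u|) = expR (r * `|u|) * expR `|u|.
    by rewrite mulrDl mul1r expRD.
  have e1 : 1 <= expR `|u| / M.
    by rewrite ler_pdivlMr// mul1r (le_trans (ltW Mu))// ler_norm_expR.
  rewrite (@le_trans _ _ (2 * C * expR (r * `|u|)))//.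
    by have := ler_wpM2l C0 h; lra.
  have -> : 2 * C / M * (expR (r * `|u|) * expR `|u|) =
    (2 * C * expR (r * `|u|)) * (expR `|u| / M) by ring.
  by rewrite ler_peMr// mulr_ge0 ?expR_ge0// mulr_ge0.
have [K KP] := mu_bnd (r + 1).
have K0 : 0 <= K by apply: le_trans (KP 0%N); apply: Rintegral_ge0 => u _; exact: expR_ge0.
pose K' := \int[mu]_u expR ((r + 1) * `|u|).
have K'0 : 0 <= K' by apply: Rintegral_ge0 => u _; exact: expR_ge0.
apply/cvgrPdist_le => e e0.
(* Makes the clamping errors under [mu_ k] and [mu] together at most [e / 2]; the [+ 1] ensures
   [M > 0]. *)
pose M := (2 * C * (K + K') + 1) / (e / 2).
have e20 : 0 < e / 2 by rewrite divr_gt0.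
have CK0 : 0 <= 2 * C * (K + K') by rewrite mulr_ge0 ?addr_ge0// mulr_ge0.
have M0 : 0 < M by rewrite divr_gt0//; lra.
have /cvgrPdist_le /(_ _ e20) := mu_weak (bfM M M0).
apply: filterS => k hk.
have h1 : `|\int[mu]_u f u - \int[mu]_u fM M u| <= 2 * C / M * K'.
  by apply: le_dist_Rintegral => //; [exact: if_|exact: bounded_continuous_integrable (bfM M M0)
    |move=> u; exact: fMd].
have h2 : `|\int[mu_ k]_u f u - \int[mu_ k]_u fM M u| <= 2 * C / M * K.
  apply: (@le_trans _ _ (2 * C / M * \int[mu_ k]_u expR ((r + 1) * `|u|))).
    apply: le_dist_Rintegral; [exact: if_| |exact: mu_int|by move=> u; exact: fMd].
    exact: bounded_continuous_integrable (bfM M M0).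
  by rewrite ler_wpM2l// divr_ge0 ?(ltW M0)// mulr_ge0.
have h3 : 2 * C / M * K' + 2 * C / M * K <= e / 2.
  have -> : 2 * C / M * K' + 2 * C / M * K = 2 * C * (K + K') / M by ring.
  rewrite ler_pdivrMr// /M [e / 2 * _]mulrC divfK ?gt_eqF//; lra.
move: h1 h2 hk; rewrite !ler_norml => /andP[? ?] /andP[? ?] /andP[? ?].
by apply/andP; split; lra.
Qed.

End ExponentialGrowth.

(** * Determination of a measure and continuity sets *)

Section ClosedSets.
Context {R : realType}.
Implicit Types (m : {finite_measure set R -> \bar R}) (f : R -> R) (C : set R).

(** For empty [C] this is the default value 0, whence the assumption [C !=set0] where positivity is
    claimed. *)
Definition dist_to C (u : R) : R := inf [set `|u - c| | c in C].

Let dist_lb C u : has_lbound [set `|u - c| | c in C].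
Proof. by exists 0 => _ [c _ <-]. Qed.

Lemma dist_to_ge0 C u : 0 <= dist_to C u.
Proof.
rewrite /dist_to; have [->|/set0P C0] := eqVneq C set0.
  by rewrite image_set0 inf0.
by apply: lb_le_inf; [exact: image_nonempty|move=> _ [c _ <-]].
Qed.

Lemma dist_to_eq0 C u : C u -> dist_to C u = 0.
Proof.
move=> Cu; apply/eqP; rewrite eq_le dist_to_ge0 andbT.
by apply: ge_inf => //; exists u => //; rewrite subrr normr0.
Qed.

Lemma dist_to_gt0 C u : closed C -> C !=set0 -> ~ C u -> 0 < dist_to C u.
Proof.
move=> /closed_openC oC C0 Cu.
have [e /= e0 eC] : nbhs u (~` C) by exact: open_nbhs_nbhs.
apply: (lt_le_trans e0); apply: lb_le_inf; first exact: image_nonempty.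
move=> _ [c Cc <-]; rewrite leNgt; apply/negP => uc.
exact: (eC c uc).
Qed.

Lemma dist_to_lipschitz C u v : C !=set0 -> dist_to C u <= dist_to C v + `|u - v|.
Proof.
move=> C0; rewrite -lerBlDr; apply: lb_le_inf; first exact: image_nonempty.
move=> _ [c Cc <-]; rewrite lerBlDr.
apply: (@le_trans _ _ `|u - c|); first by apply: ge_inf => //; exists c.
by rewrite [leRHS]addrC -(subrKA v) ler_normD.
Qed.

Lemma continuous_dist_to C : C !=set0 -> continuous (dist_to C).
Proof.
move=> C0 u; apply/cvgrPdist_lt => e e0; near=> v.
have uv : `|u - v| < e by near: v; exact: (@nbhsx_ballx _ _ u e).
have h1 := dist_to_lipschitz u v C0; have := dist_to_lipschitz v u C0.
by rewrite distrC => h2; rewrite ltr_distl; apply/andP; split; lra.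
Unshelve. all: by end_near. Qed.

Lemma measure_le_Rintegral m C f : measurable C -> bounded_continuous f ->
  (forall u, 0 <= f u) -> (forall u, C u -> 1 <= f u) ->
  (m C <= (\int[m]_u f u)%:E)%E.
Proof.
move=> mC bf f0 f1.
have -> : m C = (\int[m]_u \1_C u)%:E.
  rewrite /Rintegral integral_indic// setIT fineK//.
  exact: (fin_num_measure m _ mC).
rewrite lee_fin; apply: le_Rintegral => //.
- exact: integrable_indic.
- exact: bounded_continuous_integrable.
move=> u _; rewrite indicE; case: (boolP (u \in C)) => [|_]; last exact: f0.
by rewrite inE => /f1.
Qed.

(** The functions [1 - n * dist_to C], cut off below at 0, equal 1 on [C] and tend to 0 at each
    point off the closed set [C]; dominated convergence by the constant 1 concludes. *)
Lemma closed_approx m C (e : R) : closed C -> 0 < e ->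
  exists f, [/\ bounded_continuous f, forall u, 0 <= f u, forall u, C u -> 1 <= f u &
    ((\int[m]_u f u)%:E <= m C + e%:E)%E].
Proof.
move=> cC e0.
have mC := closed_measurable cC.
have [->|/set0P C0] := eqVneq C set0.
  exists (fun=> 0); split => //; first exact: bounded_continuous_cst.
  by rewrite Rintegral_cst// mul0r measure0 add0e lee_fin ltW.
pose fn (n : nat) (u : R) : R := clamp 0 1 (1 - n%:R * dist_to C u).
have fn_itv n u : 0 <= fn n u <= 1 by exact: clamp_itv.
have cfn n : continuous (fn n).
  have cd : continuous (fun u => 1 - n%:R * dist_to C u).
    move=> u; apply: cvgB; first exact: cvg_cst.
    by apply: cvgM; [exact: cvg_cst|exact: continuous_dist_to].
  by move=> u; exact: (continuous_comp (cd u) (@continuous_clamp R 0 1 _)).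
have bfn n : bounded_continuous (fn n).
  split => //; exists 1 => u; have /andP[f0 f1] := fn_itv n u.
  by rewrite ger0_norm.
have mfn n : measurable_fun setT (fn n) := continuous_measurable_fun (cfn n).
have fn1 n u : C u -> fn n u = 1.
  by move=> Cu; rewrite /fn dist_to_eq0// mulr0 subr0 clamp_id// ler01 lexx.
have mI : measurable_fun setT (\1_C : R -> R) by exact: measurable_indic.
have cvg_fn : {ae m, forall u, setT u -> (fn n u)%:E @[n --> \oo] --> (\1_C u)%:E}.
  apply: aeW => u _; have [Cu|Cu] := pselect (C u).
    by under eq_fun do rewrite fn1//; rewrite indicE mem_set//; exact: cvg_cst.
  rewrite indicE memNset//; apply: cvg_near_cst; near=> n.
  have d0 := dist_to_gt0 cC C0 Cu.
  rewrite /fn /clamp max_l// ge_min; apply/orP; right.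
  rewrite subr_le0 -ler_pdivrMr// div1r.
  by near: n; exact: nbhs_infty_ger.
have fn_le : {ae m, forall u n, setT u -> (`|(fn n u)%:E| <= 1)%E}.
  apply: aeW => u n _; have /andP[f0 f1] := fn_itv n u.
  by rewrite /= lee_fin ger0_norm.
have [_ _] := dominated_convergence measurableT
  (fun n => (measurable_EFinP _ _).2 (mfn n)) ((measurable_EFinP _ _).2 mI)
  cvg_fn (finite_measure_integrable_cst m 1 measurableT) fn_le.
rewrite integral_indic// setIT => dc.
have mCfin := fin_num_measure m _ mC.
have /fine_cvg/cvgr_lt : (\int[m]_u (fn n u)%:E)%E @[n --> \oo] --> (fine (m C))%:E.
  by rewrite fineK.
rewrite -(fineK mCfin).
move=> /(_ (fine (m C) + e)); rewrite ltrDl => /(_ e0) [n _ /(_ n (leqnn n)) H].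
exists (fn n); split => // [u|u Cu|]; first by have /andP[] := fn_itv n u.
  by rewrite fn1.
by rewrite -EFinD lee_fin ltW.
Unshelve. all: by end_near. Qed.

(** Integrals of bounded continuous functions determine the mass of closed sets, and the closed rays
    [[x, +oo[] form an intersection-stable generator of the Borel sets. *)
Lemma measure_ext m1 m2 :
  (forall f, bounded_continuous f -> \int[m1]_u f u = \int[m2]_u f u) ->
  forall B : set R, measurable B -> m1 B = m2 B.
Proof.
move=> m12.
have le_closed (n1 n2 : {finite_measure set R -> \bar R}) C : closed C ->
    (forall f, bounded_continuous f -> \int[n1]_u f u = \int[n2]_u f u) ->
    (n1 C <= n2 C)%E.
  move=> cC n12; apply/lee_addgt0Pr => e e0.
  have [f [bf f0 f1 fe]] := closed_approx n2 cC e0.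
  rewrite (le_trans _ fe)// -n12//; apply: measure_le_Rintegral => //.
  exact: closed_measurable.
apply: (@measure_unique _ R R (@RGenCInfty.G R) (fun n => `[- n%:R, +oo[%classic)).
- exact: RGenCInfty.measurableE.
- move=> _ _ [x ->] [y ->]; exists (Num.max x y); apply/seteqP; split => u /=.
    by rewrite !in_itv/= !andbT ge_max => -[-> ->].
  by rewrite !in_itv/= !andbT ge_max => /andP[].
- by move=> n; eexists.
- rewrite -subTset => u _; exists (Num.bound `|u|) => //=.
  rewrite in_itv/= andbT lerNl (le_trans (ler_norm _))// normrN ltW//.
  by rewrite archi_boundP.
- move=> _ [x ->]; apply/eqP; rewrite eq_le; apply/andP; split; apply: le_closed => //.
  + exact: interval_closed.
  + exact: interval_closed.
  + by move=> f bf; rewrite m12.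
- move=> n; rewrite -ge0_fin_numE//; apply: fin_num_measure; exact: measurable_itv.
Qed.

End ClosedSets.

(** * The portmanteau theorem for continuity sets *)

Section Portmanteau.
Context {R : realType} (mu_ : nat -> {finite_measure set R -> \bar R})
  (mu : {finite_measure set R -> \bar R}).
Hypothesis mu_weak : forall f, bounded_continuous f ->
  \int[mu_ k]_u f u @[k --> \oo] --> \int[mu]_u f u.

(** A continuous majorant of the indicator of [C], nearly optimal for [mu], bounds [mu_ k C] by an
    integral that converges. *)
Lemma weak_cvg_closed C (e : R) : closed C -> 0 < e ->
  \forall k \near \oo, (mu_ k C <= mu C + e%:E)%E.
Proof.
move=> cC e0; have e20 : 0 < e / 2 by rewrite divr_gt0.
have [f [bf f0 f1 fe]] := closed_approx mu cC e20.
have /cvgrPdist_le /(_ _ e20) := mu_weak bf.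
apply: filterS => k hk.
have := measure_le_Rintegral (mu_ k) (closed_measurable cC) bf f0 f1.
move/le_trans; apply.
apply: (@le_trans _ _ ((\int[mu]_u f u)%:E + (e / 2)%:E)%E).
  by rewrite -EFinD lee_fin; move: hk; rewrite ler_norml => /andP[]; lra.
by rewrite {2}(splitr e) EFinD addeA leeD2r.
Qed.

Lemma boundaryC (B : set R) : boundary (~` B) = boundary B.
Proof.
by rewrite /boundary closure_setC interiorC setDE setCK setIC -setDE.
Qed.

Lemma measurable_boundary (B : set R) : measurable (boundary B).
Proof.
apply: measurableD; first by apply: closed_measurable; exact: closed_closure.
by apply: open_measurable; exact: open_interior.
Qed.

Lemma weak_cvg_null_boundary_le (B : set R) (e : R) :
    measurable B -> mu (boundary B) = 0%E -> 0 < e ->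
  \forall k \near \oo, (mu_ k B <= mu B + e%:E)%E.
Proof.
move=> mB B0 e0; have cB := @closed_closure _ B.
apply: filterS (weak_cvg_closed cB e0) => k.
have mcB := closed_measurable cB.
have : (mu_ k B <= mu_ k (closure B))%E.
  by apply: le_measure; rewrite ?inE//; exact: subset_closure.
move=> /le_trans h /h /le_trans; apply; rewrite leeD2r//.
have : closure B `<=` B `|` boundary B.
  move=> u cBu; have [Bu|Bu] := pselect (B u); first by left.
  by right; split => // /interior_subset.
move=> sub; rewrite (@le_trans _ _ (mu (B `|` boundary B)))//.
  apply: le_measure; rewrite ?inE//; apply: measurableU => //.
  exact: measurable_boundary B.
apply: (le_trans (measureU2 mu mB (@measurable_boundary B))).
by rewrite [X in (_ + X)%E]B0 adde0.
Qed.

(** The upper bound holds for [B] and for its complement, which has the same boundary. As total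
    masses converge, the bound for the complement is a lower bound for [B]. *)
Lemma weak_cvg_continuity_set (B : set R) : measurable B -> mu (boundary B) = 0%E ->
  mu_ k B @[k --> \oo] --> mu B.
Proof.
move=> mB B0; have fin (m : {finite_measure set R -> \bar R}) A : measurable A ->
    m A = (fine (m A))%:E.
  by move=> mA; rewrite fineK//; exact: (fin_num_measure m _ mA).
have le_fine (m m' : {finite_measure set R -> \bar R}) A (e : R) : measurable A ->
    (m A <= m' A + e%:E)%E -> fine (m A) <= fine (m' A) + e.
  by move=> mA; rewrite -lee_fin EFinD -!fin.
have split (m : {finite_measure set R -> \bar R}) :
    fine (m setT) = fine (m B) + fine (m (~` B)).
  apply: EFin_inj; rewrite EFinD -!fin//; last exact: measurableC.
  by rewrite -measureU ?setUv//; [exact: measurableC|rewrite setICr].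
have totE (m : {finite_measure set R -> \bar R}) : fine (m setT) = \int[m]_u 1.
  by rewrite Rintegral_cst// mul1r.
rewrite (fin mu)//; under eq_fun do rewrite (fin (mu_ _))//.
apply: cvg_EFin; first by apply: nearW.
apply/cvgrPdist_le => e e0; have e20 : 0 < e / 2 by rewrite divr_gt0.
have /cvgrPdist_le /(_ _ e20) := mu_weak (bounded_continuous_cst 1).
have := weak_cvg_null_boundary_le (measurableC mB) _ e20.
rewrite boundaryC => /(_ B0).
have := weak_cvg_null_boundary_le mB B0 e20.
apply: filterS3 => k.
move=> /(le_fine _ _ _ _ mB) h1 /(le_fine _ _ _ _ (measurableC mB)) h2.
rewrite /= -!totE !split.
by rewrite !ler_norml => /andP[? ?]; apply/andP; split; lra.
Qed.

End Portmanteau.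

(** * Uniqueness and evenness *)

Section Uniqueness.
Context {R : realType}.
Implicit Types (m : {finite_measure set R -> \bar R}) (f : R -> R).

Lemma measure_ext_cos m1 m2 : exp_integrable m1 -> exp_integrable m2 ->
  (forall t s, \int[m1]_u cos (t * u + s) = \int[m2]_u cos (t * u + s)) ->
  forall B : set R, measurable B -> m1 B = m2 B.
Proof.
move=> i1 i2 m12; apply: measure_ext => f bf.
(* The alternating sequence m2, m1, m2, m1, ... falls under
   [is_cvg_Rintegral_bounded_continuous]. *)
pose v (k : nat) := if odd k then m1 else m2.
have vi k : exp_integrable (v k) by rewrite /v; case: ifP.
have vb : exp_bounded v.
  move=> r; exists (Num.max (\int[m1]_u expR (r * `|u|)) (\int[m2]_u expR (r * `|u|))) => k.
  by rewrite le_max /v; case: ifP => _; rewrite lexx ?orbT.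
have vc t s : cvgn (fun k => \int[v k]_u cos (t * u + s)).
  suff -> : (fun k => \int[v k]_u cos (t * u + s)) = fun=> \int[m1]_u cos (t * u + s).
    exact: is_cvg_cst.
  by apply/funext => k; rewrite /v; case: ifP => // _; rewrite m12.
have /cvgrPdist_lt cv := is_cvg_Rintegral_bounded_continuous vi vb vc bf.
apply/eqP; rewrite -subr_eq0 -normr_le0 leNgt; apply/negP => d0.
(* The indices [N.*2] and [N.*2.+1] put both integrals at less than half their mutual distance from
   one limit. *)
have [N _ H] := cv _ (divr_gt0 d0 (ltr0Sn R 1)).
have H0 := H N.*2; have H1 := H N.*2.+1.
rewrite /= -addnn leq_addr in H0; rewrite /= -addnn leqW ?leq_addr// in H1.
move: (H0 isT) (H1 isT); rewrite /v /= addnn odd_double /=.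
set l := limn _; set a := \int[m1]_u f u; set b := \int[m2]_u f u => h1 h2.
have : `|a - b| <= `|l - b| + `|l - a|.
  by rewrite [leRHS]addrC [`|l - a|]distrC -(subrKA l) ler_normD.
rewrite -/a -/b in h1 h2 *; lra.
Qed.

Lemma bounded_continuous_reflect f :
  bounded_continuous f -> bounded_continuous (fun u => f (- u)).
Proof.
move=> [cf [B fB]]; split; last by exists B.
have cN : continuous (fun u : R => - u) by move=> u; apply: cvgN; exact: cvg_id.
by move=> u; exact: (continuous_comp (cN u) (cf _)).
Qed.

Lemma even_image_opp (B : set R) : [set - x | x in B] = -%R @^-1` B.
Proof.
apply/seteqP; split => [_ [x Bx <-]|x Bx]; first by rewrite /= opprK.
by exists (- x); rewrite ?opprK.
Qed.

(** Evenness speaks of masses, weak convergence of integrals; the image measure under negation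
    connects them. *)
Lemma reflection m : exists2 m' : {finite_measure set R -> \bar R},
  forall B, m' B = m [set - x | x in B] &
  forall f, bounded_continuous f -> \int[m']_u f u = \int[m]_u f (- u).
Proof.
have mopp : measurable_fun [set: R] (-%R : R -> R) := @oppr_measurable R setT.
pose nu := measure_function_pushforward__canonical__measure_function_Measure m mopp.
have [|m' m'E] := finite_measure_of_additive (f := nu) (measure0 nu)
  (measure_ge0 nu) (@measure_semi_sigma_additive _ _ _ nu).
  by rewrite /= /pushforward preimage_setT -ge0_fin_numE//; exact: fin_num_measure.
exists m' => [B|f bf]; first by rewrite m'E even_image_opp.
have bfN := bounded_continuous_reflect bf.
rewrite /Rintegral; congr fine.
rewrite (eq_measure_integral nu); last by move=> A _ _; exact: m'E.
rewrite integral_pushforward//.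
- apply/measurable_EFinP; exact: (continuous_measurable_fun bf.1).
- rewrite preimage_setT; exact: (bounded_continuous_integrable m bfN).
Qed.

Lemma weak_limit_even (mu_ : nat -> {finite_measure set R -> \bar R}) m :
  (forall f, bounded_continuous f -> \int[mu_ k]_u f u @[k --> \oo] --> \int[m]_u f u) ->
  (forall k, even_measure (mu_ k)) -> even_measure m.
Proof.
move=> mw ev B mB; have [m' m'E m'f] := reflection m.
rewrite -m'E; apply: measure_ext mB => f bf; rewrite m'f//.
have bfN := bounded_continuous_reflect bf.
apply/esym/(cvg_unique _ (mw _ bf)) => //.
have -> : (fun k => \int[mu_ k]_u f u) = (fun k => \int[mu_ k]_u f (- u)).
  apply/funext => k; have [n nE nf] := reflection (mu_ k); rewrite -nf//.
  rewrite /Rintegral; congr fine; apply: eq_measure_integral => A mA _.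
  exact: (esym (etrans (nE A) (ev k A mA))).
exact: mw.
Qed.

End Uniqueness.

(** * Compact support and integrability *)

Section CompactSupport.
Context {R : realType}.
Implicit Types (m : {finite_measure set R -> \bar R}) (f : R -> R).

Lemma measurable_norm_gt (A : R) : measurable [set u : R | A < `|u|].
Proof.
apply: open_measurable; rewrite (_ : mkset _ = Num.norm @^-1` [set x | A < x])//.
by apply: open_comp; [move=> u _; exact: norm_continuous|exact: open_gt].
Qed.

(** The complement of the support is null because the topology has a countable base: each of its
    points lies in a null interval with rational endpoints. *)
Lemma compactly_supported_null m : compactly_supported m ->
  exists2 M : R, 0 < M & m [set u | M < `|u|] = 0%E.
Proof.
move=> /compact_bounded [M0 [_ HM]].
pose M := `|M0| + 1; exists M; first by rewrite ltr_wpDl.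
have suppM u : measure_support m u -> `|u| <= M.
  by apply: HM; rewrite (le_lt_trans (ler_norm _))// ltrDl.
pose I (pq : rat * rat) : set R := `]ratr pq.1, ratr pq.2[%classic.
(* Enumerates the null rational intervals; codes of no pair and intervals of positive mass yield the
   empty set. *)
pose F k : set R := if unpickle k is Some pq then
  (if m (I pq) == 0%E then I pq else set0) else set0.
have Fnegl k : m.-negligible (F k).
  rewrite /F; case: unpickle => [pq|]; last exact: negligible_set0.
  case: ifP => [/eqP I0|_]; last exact: negligible_set0.
  by apply/negligibleP => //; exact: measurable_itv.
apply: measure_negligible; first exact: measurable_norm_gt.
apply: negligibleS (negligible_bigcup Fnegl) => u /= Mu.
have : ~ measure_support m u by move=> /suppM; rewrite leNgt Mu.
move=> /existsNP [U /not_implyP[oU /not_implyP[Uu /negP mU]]].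
have [e /= e0 eU] : nbhs u U by exact: open_nbhs_nbhs.
have ue : u - e < u by rewrite ltrBlDr ltrDl.
have eu : u < u + e by rewrite ltrDl.
have [p] := rat_in_itvoo ue; rewrite in_itv/= => /andP[pe pu].
have [q] := rat_in_itvoo eu; rewrite in_itv/= => /andP[qu qe].
have [k Fk] : exists k, F k = if m (I (p, q)) == 0%E then I (p, q) else set0.
  by exists (pickle (p, q)); rewrite /F pickleK.
exists k => //; rewrite Fk.
have IU : I (p, q) `<=` U.
  move=> v; rewrite /I /= in_itv/= => /andP[pv vq]; apply: eU => /=.
  by rewrite ltr_distlC; apply/andP; split; lra.
have -> : m (I (p, q)) == 0%E.
  rewrite -measure_le0 (@le_trans _ _ (m U))//; last by rewrite leNgt.
  by apply: le_measure => //; rewrite inE; [exact: measurable_itv|exact: open_measurable].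
by rewrite /I /= in_itv/= pu.
Qed.

Lemma compactly_supported_integrable m f : compactly_supported m -> continuous f ->
  m.-integrable setT (EFin \o f).
Proof.
move=> /compactly_supported_null [M M0 mM] cf.
have mf : measurable_fun setT (EFin \o f).
  by apply/measurable_EFinP; exact: (continuous_measurable_fun cf).
have mN := measurable_norm_gt M.
apply/(negligible_integrable mN measurableT mf mM).
apply: measurable_bounded_integrable.
- exact: measurableD.
- by rewrite -ge0_fin_numE//; apply: fin_num_measure; exact: measurableD.
- by apply: measurable_funTS; exact: continuous_measurable_fun.
have cs : compact (f @` `[- M, M]).
  apply: continuous_compact; last exact: segment_compact.
  exact: continuous_subspaceT.
have [B [Br HB]] := compact_bounded cs.
exists B; split => // N BN u /= [_ /negP].
rewrite -leNgt ler_norml => uM; apply: (HB N BN (f u)).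
by exists u => //=; rewrite in_itv.
Qed.

End CompactSupport.

(** * Complex differentiability of the transform *)

Section ElementaryBounds.
Context {R : realType}.
Implicit Types (x p q : R).

(** Source of the bounds on [sin] and [cos] below, for [x] of either sign. Only the order in [x]
    matters there, so the constants are generous. *)
Lemma mean_value_from0 (f df : R -> R) x : (forall y : R, is_derive y 1 f (df y)) ->
  exists2 c, `|c| <= `|x| & f x - f 0 = df c * x.
Proof.
move=> fdf.
have cf : continuous f.
  by move=> y; apply: differentiable_continuous; apply/derivable1_diffP; case: (fdf y).
have [x0|x0] := leP 0 x.
  have [c] := MVT_segment x0 (fun y _ => fdf y) (continuous_subspaceT cf).
  rewrite in_itv/= subr0 => /andP[c0 cx] ->; exists c => //.
  by rewrite !ger0_norm// (le_trans c0).
have [c] := MVT_segment (ltW x0) (fun y _ => fdf y) (continuous_subspaceT cf).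
rewrite in_itv/= sub0r => /andP[cx c0] E; exists c.
  by rewrite (ler0_norm c0) (ltr0_norm x0) lerN2.
by rewrite -opprB E; ring.
Qed.

Lemma norm_sin_le x : `|sin x| <= `|x|.
Proof.
have [c _] := @mean_value_from0 sin cos x (@is_derive_sin R).
by rewrite sin0 subr0 => ->; rewrite normrM ler_piMl// cos_max.
Qed.

Lemma norm_1Bcos_le x : `|1 - cos x| <= x ^+ 2.
Proof.
have [c cx] := @mean_value_from0 cos (fun x => - sin x) x (@is_derive_cos R).
rewrite cos0 -[`|1 - _|]normrN opprB => ->.
rewrite normrM normrN -[leRHS]ger0_norm ?sqr_ge0// normrX expr2.
by rewrite ler_wpM2r// (le_trans (norm_sin_le _)).
Qed.

Lemma norm_sinB_le x : `|sin x - x| <= x ^+ 2.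
Proof.
have dx (y : R) : is_derive y 1 (fun y => sin y - y) (cos y - 1) by exact: is_deriveB.
have [c cx] := mean_value_from0 x dx.
rewrite sin0 !subr0 => ->.
rewrite normrM -[leRHS]ger0_norm ?sqr_ge0// normrX expr2 ler_wpM2r//.
rewrite (le_trans _ cx)//.
have [d _] := @mean_value_from0 cos (fun x => - sin x) c (@is_derive_cos R).
by rewrite cos0 => ->; rewrite normrM normrN ler_piMl// sin_max.
Qed.

Lemma norm_expRB1_le p : `|expR p - 1| <= `|p| * expR `|p|.
Proof.
have h1 := expR_ge1Dx p; have h2 := expR_ge1Dx (- p).
have e0 := expR_gt0 p; have eN := expR_gt0 (- p).
have ee := expRxMexpNx_1 p.
have [p0|p0] := leP 0 p.
  rewrite (ger0_norm p0) ger0_norm; last by lra.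
  have := mulr_ge0 (ltW e0) (_ : 0 <= expR (- p) - 1 + p); lra.
rewrite (ltr0_norm p0) ler0_norm; last by rewrite subr_le0 expR_le1 ltW.
have : 1 <= expR (- p) by lra.
by nra.
Qed.

Lemma norm_expRB1Bid_le p : `|expR p - 1 - p| <= p ^+ 2 * expR `|p|.
Proof.
have h1 := expR_ge1Dx p; have h2 := expR_ge1Dx (- p).
have e0 := expR_gt0 p; have eN := expR_gt0 (- p).
have ee := expRxMexpNx_1 p.
rewrite ger0_norm; last by lra.
(* Multiplying [1 - p <= expR (- p)] by [expR p] gives [expR p <= 1 + p * expR p]. *)
apply: (@le_trans _ _ (p * (expR p - 1))).
  have := mulr_ge0 (ltW e0) (_ : 0 <= expR (- p) - 1 + p); lra.
apply: (le_trans (ler_norm _)); rewrite normrM.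
have -> : p ^+ 2 = `|p| * `|p| by rewrite -expr2 real_normK ?num_real.
by rewrite -mulrA ler_wpM2l// norm_expRB1_le.
Qed.

(** This and the next lemma bound the real and imaginary parts of exp (p + i q) - 1 - (p + i q). *)
Lemma norm_expR_cosB_le p q :
  `|expR p * cos q - 1 - p| <= (p ^+ 2 + q ^+ 2) * expR `|p|.
Proof.
have -> : expR p * cos q - 1 - p = (expR p - 1 - p) - expR p * (1 - cos q) by ring.
rewrite (le_trans (ler_normB _ _))// mulrDl lerD ?norm_expRB1Bid_le//.
rewrite normrM (gtr0_norm (expR_gt0 p)) mulrC.
by rewrite ler_pM ?expR_ge0 ?norm_1Bcos_le// ler_expR ler_norm.
Qed.

Lemma norm_expR_sinB_le p q :
  `|expR p * sin q - q| <= 2 * (p ^+ 2 + q ^+ 2) * expR `|p|.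
Proof.
have -> : expR p * sin q - q = (expR p - 1) * sin q + (sin q - q) by ring.
have e1 : 1 <= expR `|p| by rewrite (le_trans _ (expR_ge1Dx _))// lerDl.
rewrite (le_trans (ler_normD _ _))// normrM.
have h1 : `|expR p - 1| * `|sin q| <= `|p| * expR `|p| * `|q|.
  by rewrite ler_pM ?norm_expRB1_le ?norm_sin_le.
have h2 := norm_sinB_le q.
have p2 : p ^+ 2 = `|p| ^+ 2 by rewrite real_normK ?num_real.
have q2 : q ^+ 2 = `|q| ^+ 2 by rewrite real_normK ?num_real.
rewrite p2 q2 in h2 *.
have := normr_ge0 p; have := normr_ge0 q.
move: h1 h2 e1; set a := `|p|; set b := `|q|; set e := expR a => h1 h2 e1 b0 a0.
have h3 : b ^+ 2 <= b ^+ 2 * e by rewrite ler_peMr// sqr_ge0.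
have h4 : a * b * e <= (a ^+ 2 + b ^+ 2) * e by rewrite ler_wpM2r; nra.
have h5 : 0 <= a ^+ 2 * e by rewrite mulr_ge0 ?sqr_ge0//; lra.
by nra.
Qed.

Lemma normrX_le_expR n x : `|x ^+ n| <= expR (n%:R * `|x|).
Proof. by rewrite expRM_natl normrX lerXn2r ?nnegrE ?expR_ge0// ler_norm_expR. Qed.

End ElementaryBounds.

(** * Real waves and their Taylor expansion *)

Section Waves.
Context {R : realType}.
Implicit Types (m : {finite_measure set R -> \bar R}) (x y phi s t u : R).

(** With [z = x + i y], the real part of exp (i phi) times [u ^+ n] times exp (i z u). Phase 0 gives
    the real part of the kernel, phase [- pi / 2] its imaginary part. *)
Definition wave n x y phi u : R := u ^+ n * (expR (- (y * u)) * cos (x * u + phi)).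

Lemma continuous_wave n x y phi : continuous (wave n x y phi).
Proof.
have cexpR : continuous (fun u => expR (- (y * u))).
  have cl : continuous (fun u => - (y * u)).
    by move=> u; apply: cvgN; apply: cvgM; [exact: cvg_cst|exact: cvg_id].
  by move=> u; exact: (continuous_comp (cl u) (@continuous_expR R _)).
move=> u; apply: cvgM; first exact: exprn_continuous.
by apply: cvgM; [exact: cexpR|exact: (bounded_continuous_cos x phi).1].
Qed.

Lemma wave_bound n x y phi u :
  `|wave n x y phi u| <= 1 * expR ((n%:R + `|y|) * `|u|).
Proof.
rewrite mul1r mulrDl expRD normrM ler_pM ?normrX_le_expR//.
rewrite normrM (gtr0_norm (expR_gt0 _)) -[leRHS]mulr1.
rewrite ler_pM ?expR_ge0 ?cos_max// ler_expR.
by rewrite -normrM (le_trans (ler_norm _))// normrN.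
Qed.

Lemma wave_integrable m n x y phi : exp_integrable m ->
  m.-integrable setT (EFin \o wave n x y phi).
Proof.
move=> mi; apply: integrable_le_continuous (mi (n%:R + `|y|)) _.
  exact: continuous_wave.
by move=> u; have := wave_bound n x y phi u; rewrite mul1r.
Qed.

(** Differentiating in [x] or [y] raises [n] by one, with a phase shift in the case of [x]. The
    factor 3 is 1 + 2 from the cosine and sine remainders; in the exponent, [n + |y|] absorbs the
    wave, 2 the factor [u ^+ 2], and 1 the increment [t]. *)
Lemma wave_taylor n x y phi s t u : `|t| <= 1 ->
  `|wave n (x + s) (y + t) phi u - (wave n x y phi u +
     (- s * wave n.+1 x y (phi - pi / 2) u + - t * wave n.+1 x y phi u))| <=
  3 * (s ^+ 2 + t ^+ 2) * expR ((n%:R + 3 + `|y|) * `|u|).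
Proof.
move=> t1; rewrite /wave.
have -> : x * u + (phi - pi / 2) = (x * u + phi) - pi / 2 by ring.
rewrite cosBpihalf.
have -> : - ((y + t) * u) = - (y * u) + (- t * u) by ring.
have -> : (x + s) * u + phi = (x * u + phi) + s * u by ring.
rewrite expRD cosD.
set a := expR (- (y * u)); set b := x * u + phi; set p := - t * u; set q := s * u.
have -> : u ^+ n * (a * expR p * (cos b * cos q - sin b * sin q)) -
   (u ^+ n * (a * cos b) + (- s * (u ^+ n.+1 * (a * sin b)) + - t * (u ^+ n.+1 * (a * cos b)))) =
   u ^+ n * a * (cos b * (expR p * cos q - 1 - p) - sin b * (expR p * sin q - q)).
  by rewrite exprS /p /q; ring.
have pu : `|p| <= `|u| by rewrite /p normrM normrN ler_piMl.
have pq : p ^+ 2 + q ^+ 2 = (s ^+ 2 + t ^+ 2) * u ^+ 2 by rewrite /p /q; ring.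
have r1 := norm_expR_cosB_le p q; have r2 := norm_expR_sinB_le p q.
have epu : expR `|p| <= expR `|u| by rewrite ler_expR.
have r : `|cos b * (expR p * cos q - 1 - p) - sin b * (expR p * sin q - q)| <=
    3 * (s ^+ 2 + t ^+ 2) * (u ^+ 2 * expR `|u|).
  rewrite (le_trans (ler_normB _ _))// !normrM.
  have h1 : `|cos b| * `|expR p * cos q - 1 - p| <= `|expR p * cos q - 1 - p|.
    by rewrite ler_piMl// cos_max.
  have h2 : `|sin b| * `|expR p * sin q - q| <= `|expR p * sin q - q|.
    by rewrite ler_piMl// sin_max.
  apply: (le_trans (lerD (le_trans h1 r1) (le_trans h2 r2))).
  rewrite pq; set S := _ + t ^+ 2.
  have -> : 3 * S * (u ^+ 2 * expR `|u|) = 3 * (S * u ^+ 2) * expR `|u| by ring.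
  have -> : S * u ^+ 2 * expR `|p| + 2 * (S * u ^+ 2) * expR `|p| =
    3 * (S * u ^+ 2) * expR `|p| by ring.
  by rewrite ler_wpM2l// mulr_ge0// mulr_ge0 ?sqr_ge0// addr_ge0 ?sqr_ge0.
rewrite normrM.
have S0 : 0 <= 3 * (s ^+ 2 + t ^+ 2) by rewrite mulr_ge0// addr_ge0 ?sqr_ge0.
have h3 : `|u ^+ n * a| <= expR ((n%:R + `|y|) * `|u|).
  rewrite normrM mulrDl expRD ler_pM ?normrX_le_expR// (gtr0_norm (expR_gt0 _)).
  by rewrite ler_expR -normrM (le_trans (ler_norm _))// normrN.
have h4 : u ^+ 2 * expR `|u| <= expR (3 * `|u|).
  have -> : 3 * `|u| = 2%:R * `|u| + `|u| by ring.
  rewrite expRD ler_wpM2r ?expR_ge0//.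
  by rewrite (le_trans (ler_norm _))// normrX_le_expR.
have -> : (n%:R + 3 + `|y|) * `|u| = (n%:R + `|y|) * `|u| + 3 * `|u| by ring.
rewrite expRD mulrCA; apply: ler_pM => //.
by apply: (le_trans r); rewrite ler_wpM2l.
Qed.

Definition wave_integral m n x y phi : R := \int[m]_u wave n x y phi u.

Lemma wave_integral_taylor m n x y phi : exp_integrable m ->
  exists2 K, 0 <= K & forall s t, `|t| <= 1 ->
   `|wave_integral m n (x + s) (y + t) phi - (wave_integral m n x y phi +
     (- s * wave_integral m n.+1 x y (phi - pi / 2) +
      - t * wave_integral m n.+1 x y phi))| <= K * (s ^+ 2 + t ^+ 2).
Proof.
move=> mi; pose r : R := n%:R + 3 + `|y|.
exists (3 * \int[m]_u expR (r * `|u|)).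
  by rewrite mulr_ge0//; apply: Rintegral_ge0 => u _; exact: expR_ge0.
move=> s t t1.
have iZ c n' phi' : m.-integrable setT (EFin \o (fun u => c * wave n' x y phi' u)).
  have := integrableZl measurableT c (wave_integrable n' x y phi' mi).
  exact: eq_integrable.
have iD : m.-integrable setT (EFin \o (fun u => - s * wave n.+1 x y (phi - pi / 2) u
    + - t * wave n.+1 x y phi u)).
  have := integrableD measurableT (iZ (- s) n.+1 (phi - pi / 2)) (iZ (- t) n.+1 phi).
  exact: eq_integrable.
have iW := wave_integrable n x y phi mi.
have iS : m.-integrable setT (EFin \o (fun u => wave n x y phi u +
    (- s * wave n.+1 x y (phi - pi / 2) u + - t * wave n.+1 x y phi u))).
  have := integrableD measurableT iW iD.
  exact: eq_integrable.
have -> : wave_integral m n x y phi +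
     (- s * wave_integral m n.+1 x y (phi - pi / 2) +
      - t * wave_integral m n.+1 x y phi) = \int[m]_u (wave n x y phi u +
    (- s * wave n.+1 x y (phi - pi / 2) u + - t * wave n.+1 x y phi u)).
  rewrite (RintegralD measurableT iW iD).
  rewrite (RintegralD measurableT (iZ _ _ _) (iZ _ _ _)).
  by rewrite !(RintegralZl _ measurableT (wave_integrable _ _ _ _ mi)).
rewrite mulrAC; apply: le_dist_Rintegral iS (mi r) _.
  exact: wave_integrable.
by move=> u; exact: wave_taylor.
Qed.

(** Two quarter turns make a sign: the [x]-derivative of the imaginary part shifts a phase that is
    already [- pi / 2]. *)
Lemma waveN n x y u : wave n x y (- pi / 2 - pi / 2) u = - wave n x y 0 u.
Proof.
rewrite /wave (_ : x * u + _ = (x * u + 0) - pi); last by field.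
by rewrite cosB cospi sinpi; ring.
Qed.

End Waves.

(** * Complex derivative of the transform *)

Section ComplexDerivative.
Context {R : realType}.
Implicit Types (f : R[i] -> R[i]) (z h l K : R[i]).

(** The difference quotient is within [K * |h|] of [l]. In the order of [R[i]], [0 <= K] makes [K]
    real. *)
Lemma is_derive_quadratic f z l K : 0 <= K ->
  (forall h, `|h| <= 1 -> `|f (z + h) - (f z + h * l)| <= K * `|h| ^+ 2) ->
  is_derive z 1 f l.
Proof.
move=> K0 H.
have cv : h^-1 *: ((f \o shift z) (h *: 1) - f z) @[h --> 0^'] --> l.
  apply/cvgrPdist_lt => e e0.
  near=> h.
  have h0 : h != 0 by near: h; exact: nbhs_dnbhs_neq.
  have h1 : `|h| <= 1.
    near: h; apply: dnbhs0_le; exact: ltr01.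
  have he : `|h| < e / (K + 1).
    near: h; apply: dnbhs0_lt; rewrite divr_gt0// ltr_wpDl//.
  have hn : 0 < `|h| by rewrite normr_gt0.
  have K1 : 0 < K + 1 by rewrite ltr_wpDl.
  have -> : l - h^-1 *: ((f \o shift z) (h *: 1) - f z) =
      - (h^-1 * (f (z + h) - (f z + h * l))).
    have -> : (f \o shift z) (h *: 1) = f (z + h).
      by rewrite /= /shift/= addrC; congr (f (z + _)); exact: mulr1.
    have -> : forall w : R[i], h^-1 *: w = h^-1 * w by [].
    by field.
  rewrite normrN normrM normfV mulrC ltr_pdivrMr//.
  apply: le_lt_trans (H _ h1) _.
  rewrite expr2 mulrA ltr_pM2r//.
  apply: (@le_lt_trans _ _ ((K + 1) * `|h|)); first by rewrite ler_wpM2r// lerDl.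
  by rewrite mulrC -ltr_pdivlMr.
apply: DeriveDef; first by apply/cvg_ex; exists l.
exact: cvg_lim.
Unshelve. all: by end_near. Qed.

End ComplexDerivative.

Section ComplexComponents.
Context {R : realType}.
Implicit Types (z w h : R[i]) (m : {finite_measure set R -> \bar R}).

Lemma normc2E z : `|z| ^+ 2 = (complex.Re z ^+ 2 + complex.Im z ^+ 2)%:C.
Proof.
rewrite normc_def -rmorphXn /= sqr_sqrtr//.
by rewrite addr_ge0 ?sqr_ge0.
Qed.

Lemma normc_le_components z : `|z| <= (`|complex.Re z| + `|complex.Im z|)%:C.
Proof.
rewrite normc_def lecR -[leRHS]ger0_norm ?addr_ge0// -sqrtr_sqr ler_wsqrtr//.
rewrite -[complex.Re z ^+ 2]real_normK ?num_real// -[complex.Im z ^+ 2]real_normK ?num_real//.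
have := normr_ge0 (complex.Re z); have := normr_ge0 (complex.Im z); nra.
Qed.

Lemma normc_ge_Im z : `|complex.Im z|%:C <= `|z|.
Proof.
rewrite normc_def lecR -sqrtr_sqr ler_wsqrtr// lerDr sqr_ge0//.
Qed.

Lemma cvg_complexP T (F : set_system T) {FF : Filter F} (f : T -> R[i]) (l : R[i]) :
  f @ F --> l <->
  complex.Re (f x) @[x --> F] --> complex.Re l /\
  complex.Im (f x) @[x --> F] --> complex.Im l.
Proof.
split => [fl|[fR fI]].
  split; apply/cvgrPdist_lt => e e0.
    have e0' : 0 < e%:C by rewrite ltcR.
    have /cvgrPdist_lt /(_ _ e0') := fl; apply: filterS => x.
    move=> /(le_lt_trans (normc_ge_Re _)); rewrite ltcR.
    by case: l {fl} => ? ?; case: (f x).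
  have e0' : 0 < e%:C by rewrite ltcR.
  have /cvgrPdist_lt /(_ _ e0') := fl; apply: filterS => x.
  move=> /(le_lt_trans (normc_ge_Im _)); rewrite ltcR.
  by case: l {fl} => ? ?; case: (f x).
(* A positive element of [R[i]] has imaginary part 0, so the radius is a real number. *)
apply/cvgrPdist_lt => -[e e']; rewrite ltcE /= => /andP[/eqP -> e0].
have e20 : 0 < e / 2 by rewrite divr_gt0.
have /cvgrPdist_lt /(_ _ e20) := fR; have /cvgrPdist_lt /(_ _ e20) := fI.
apply: filterS2 => x hI hR.
apply: (le_lt_trans (normc_le_components _)); rewrite ltcR.
by case: l {fR fI} hI hR => a b /=; case: (f x) => c d /=; lra.
Qed.

(** The integral of [u ^+ n] times exp (i z u): up to the factor i to the power [n], the [n]-th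
    derivative of the Fourier-Laplace transform. *)
Definition transform m n z : R[i] :=
  wave_integral m n (complex.Re z) (complex.Im z) 0 +i*
  wave_integral m n (complex.Re z) (complex.Im z) (- pi / 2).

Lemma Re_cexp_kernel z u :
  complex.Re (cexp_kernel z u) = wave 0 (complex.Re z) (complex.Im z) 0 u.
Proof.
case: z => x y; rewrite /cexp_kernel /cexp /wave /=.
have -> : (0 * x - 1 * y) * u - (0 * y + 1 * x) * 0 = - (y * u) by ring.
have -> : (0 * x - 1 * y) * 0 + (0 * y + 1 * x) * u = x * u by ring.
by rewrite expr0 addr0; ring.
Qed.

Lemma Im_cexp_kernel z u :
  complex.Im (cexp_kernel z u) = wave 0 (complex.Re z) (complex.Im z) (- pi / 2) u.
Proof.
case: z => x y; rewrite /cexp_kernel /cexp /wave /= mulNr cosBpihalf.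
have -> : (0 * x - 1 * y) * u - (0 * y + 1 * x) * 0 = - (y * u) by ring.
have -> : (0 * x - 1 * y) * 0 + (0 * y + 1 * x) * u = x * u by ring.
by rewrite expr0; ring.
Qed.

Lemma fourier_laplaceE m z : fourier_laplace m z = transform m 0 z.
Proof.
rewrite /fourier_laplace /cintegral /transform /wave_integral.
by congr (_ +i* _); apply: eq_Rintegral => u _; [exact: Re_cexp_kernel|exact: Im_cexp_kernel].
Qed.

Lemma cintegrable_cexp_kernel m z : exp_integrable m -> cintegrable m (cexp_kernel z).
Proof.
move=> mi; rewrite /cintegrable.
have -> : (fun u => complex.Re (cexp_kernel z u)) =
    wave 0 (complex.Re z) (complex.Im z) 0.
  by apply/funext => u; rewrite Re_cexp_kernel.
have -> : (fun u => complex.Im (cexp_kernel z u)) =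
    wave 0 (complex.Re z) (complex.Im z) (- pi / 2).
  by apply/funext => u; rewrite Im_cexp_kernel.
by split; exact: wave_integrable.
Qed.

(** The linear terms of the two real expansions combine into multiplication of [h] by one complex
    number, which is the Cauchy-Riemann relation. The factor [c] lets the lemma apply again to its
    own derivative. *)
Lemma is_derive_transform m n (c z : R[i]) : exp_integrable m ->
  is_derive z 1 (fun z => c * transform m n z) (c * ((0 +i* 1) * transform m n.+1 z)).
Proof.
move=> mi; set x := complex.Re z; set y := complex.Im z.
have [K1 K10 H1] := wave_integral_taylor n x y 0 mi.
have [K2 K20 H2] := wave_integral_taylor n x y (- pi / 2) mi.
apply: (@is_derive_quadratic _ _ _ _ (`|c| * (K1 + K2)%:C)).
  by rewrite mulr_ge0// lecR addr_ge0.
move=> h h1.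
have t1 : `|complex.Im h| <= 1 by rewrite -lecR (le_trans (normc_ge_Im h)).
have {}H1 := H1 (complex.Re h) _ t1; have {}H2 := H2 (complex.Re h) _ t1.
have WN : wave_integral m n.+1 x y (- pi / 2 - pi / 2) = - wave_integral m n.+1 x y 0.
  rewrite /wave_integral; under eq_Rintegral do rewrite waveN -mulN1r.
  by rewrite RintegralZl ?mulN1r//; exact: wave_integrable.
have -> : c * transform m n (z + h) -
    (c * transform m n z + h * (c * ((0 +i* 1) * transform m n.+1 z))) =
    c * (transform m n (z + h) - (transform m n z +
      h * ((0 +i* 1) * transform m n.+1 z))) by ring.
rewrite normrM -mulrA ler_wpM2l//.
apply: (le_trans (normc_le_components _)).
rewrite normc2E -rmorphM /= lecR mulrDl.
rewrite WN sub0r -mulNr in H1 H2.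
set D := transform m n (z + h) - _.
have ReD : complex.Re D = wave_integral m n (x + complex.Re h) (y + complex.Im h) 0 -
    (wave_integral m n x y 0 +
     (- complex.Re h * wave_integral m n.+1 x y (- pi / 2) +
      - complex.Im h * wave_integral m n.+1 x y 0)).
  rewrite /D /transform /x /y; case: (z) => a b; case: (h) => s t /=; ring.
have ImD : complex.Im D = wave_integral m n (x + complex.Re h) (y + complex.Im h) (- pi / 2) -
    (wave_integral m n x y (- pi / 2) +
     (- complex.Re h * - wave_integral m n.+1 x y 0 +
      - complex.Im h * wave_integral m n.+1 x y (- pi / 2))).
  rewrite /D /transform /x /y; case: (z) => a b; case: (h) => s t /=; ring.
by rewrite ReD ImD lerD.
Qed.

End ComplexComponents.

(** * Exponential moments, uniqueness and tails from the transform *)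

Section TransformConsequences.
Context {R : realType}.
Implicit Types (m : {finite_measure set R -> \bar R}) (z : R[i]) (r t s u A : R).

Lemma compactly_supported_exp_integrable m : compactly_supported m -> exp_integrable m.
Proof.
by move=> cm r; apply: compactly_supported_integrable => //; exact: continuous_expR_norm.
Qed.

Lemma wave_expR r u : wave 0 0 (- r) 0 u = expR (r * u).
Proof. by rewrite /wave expr0 mul0r addr0 cos0 mulNr opprK; ring. Qed.

Lemma expR_norm_le_wave r u :
  expR (r * `|u|) <= wave 0 0 (- r) 0 u + wave 0 0 r 0 u.
Proof.
rewrite -[in X in _ + X](opprK r) !wave_expR.
have [u0|u0] := leP 0 u; first by rewrite ger0_norm// lerDl expR_ge0.
by rewrite ltr0_norm// mulrN mulNr lerDr expR_ge0.
Qed.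

Lemma Rintegral_cosE m t s : exp_integrable m ->
  \int[m]_u cos (t * u + s) =
  cos s * complex.Re (transform m 0 (t +i* 0)) - sin s * complex.Im (transform m 0 (t +i* 0)).
Proof.
move=> mi; have wi phi := wave_integrable 0 t 0 phi mi.
rewrite /transform /= /wave_integral -!RintegralZl// -RintegralB//.
- apply: eq_Rintegral => u _; rewrite /wave expr0 mul0r oppr0 expR0 addr0 mulNr cosBpihalf.
  by rewrite cosD; ring.
- by have := integrableZl measurableT (cos s) (wi 0); apply: eq_integrable.
- by have := integrableZl measurableT (sin s) (wi (- pi / 2)); apply: eq_integrable.
Qed.

(** Absolute convergence at the two points [i r] and [- i r] dominates [expR (r * |u|)]. *)
Lemma represents_exp_integrable m G : represents m G -> exp_integrable m.
Proof.
move=> mG r.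
have iw (r' : R) : m.-integrable setT (EFin \o wave 0 0 r' 0).
  have [[+ _] _] := mG (0 +i* r').
  have -> // : (fun u => complex.Re (cexp_kernel (0 +i* r') u)) = wave 0 0 r' 0.
  by apply/funext => u; rewrite Re_cexp_kernel.
apply: (@integrable_le_continuous _ _ _ (fun u => wave 0 0 (- r) 0 u + wave 0 0 r 0 u)).
- exact: continuous_expR_norm.
- by have := integrableD measurableT (iw (- r)) (iw r); apply: eq_integrable.
- by move=> u; rewrite ger0_norm ?expR_ge0// expR_norm_le_wave.
Qed.

Lemma represents_unique m1 m2 (G : R[i] -> R[i]) : represents m1 G -> represents m2 G ->
  forall B : set R, measurable B -> m1 B = m2 B.
Proof.
move=> r1 r2.
have i1 := represents_exp_integrable r1; have i2 := represents_exp_integrable r2.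
apply: measure_ext_cos => // t s; rewrite !Rintegral_cosE//.
by rewrite -!fourier_laplaceE -(r1 _).2 -(r2 _).2.
Qed.

(** Markov's inequality with an exponential weight, used for the quadratic tails with [r = 3] and
    for the masses of the tails with [r = 1]. *)
Lemma integral_tail_le m (f : R -> R) r A : exp_integrable m -> continuous f -> 0 < A ->
  (forall u, 0 <= f u) -> (forall u, A < `|u| -> f u * A <= expR (r * `|u|)) ->
  (\int[m]_(u in [set u : R | (A < `|u|)%R]) (f u)%:E <=
     (A^-1 * \int[m]_u expR (r * `|u|))%:E)%E.
Proof.
move=> mi cf A0 f0 fA.
have mA := measurable_norm_gt A.
have iw : m.-integrable setT (EFin \o (fun u => A^-1 * expR (r * `|u|))).
  by have := integrableZl measurableT A^-1 (mi r); apply: eq_integrable.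
have mw := measurable_int _ iw.
rewrite -(RintegralZl _ measurableT (mi r)) fineK; last exact: integrable_fin_num iw.
apply: (@le_trans _ _ (\int[m]_(u in [set u : R | (A < `|u|)%R]) (A^-1 * expR (r * `|u|))%:E)%E).
  apply: ge0_le_integral => //.
  - by move=> u _; rewrite lee_fin.
  - apply/measurable_EFinP; apply: measurable_funTS; exact: continuous_measurable_fun.
  - exact: measurable_funTS mw.
  - by move=> u /= Au; rewrite lee_fin mulrC ler_pdivlMr// fA.
apply: ge0_subset_integral => //.
by move=> u _; rewrite lee_fin mulr_ge0 ?expR_ge0// invr_ge0 ltW.
Qed.

Lemma cvg_ereal_sup_tail (v : nat -> R -> \bar R) K : 0 <= K ->
  (forall k A, (0 <= v k A)%E) ->
  (forall k A, 0 < A -> (v k A <= (A^-1 * K)%:E)%E) ->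
  ereal_sup (range (fun k => v k A)) @[A --> +oo] --> 0%E.
Proof.
move=> K0 v0 vK.
have AK : (A^-1 * K)%:E @[A --> +oo] --> 0%E.
  apply: cvg_EFin; first by apply: nearW.
  apply/cvgrPdist_le => e e0; near=> A.
  have KA : K / e < A by near: A; apply: nbhs_pinfty_gt; exact: num_real.
  have A0 : 0 < A by apply: le_lt_trans KA; rewrite divr_ge0// ltW.
  rewrite sub0r normrN ger0_norm; last by rewrite mulr_ge0// invr_ge0 ltW.
  by rewrite ler_pdivrMl// -ler_pdivrMr// ltW.
apply: (squeeze_cvge _ (cvg_cst 0%E) AK); near=> A.
have A0 : 0 < A by near: A; apply: nbhs_pinfty_gt; exact: num_real.
apply/andP; split.
  by apply: (le_trans (v0 0%N A)); apply: ereal_sup_ubound; exists 0%N.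
by apply: ub_ereal_sup => _ [k _ <-]; exact: vK.
Unshelve. all: by end_near. Qed.

End TransformConsequences.

(** * The limit measure and its properties *)

Unset Implicit Arguments.

Theorem proposition2p1 (R : realType)
    (mu_ : nat -> {finite_measure set R -> \bar R})
    (G : R[i] -> R[i])
    (mu_even : forall k : nat, even_measure (mu_ k))
    (mu_csupp : forall k : nat, compactly_supported (mu_ k))
    (cvgG : locally_uniform_cvg (fun k : nat => fourier_laplace (mu_ k)) G)
    (G0 : 0 < G 0) :
  exists mu : {finite_measure set R -> \bar R},
    (* existence and uniqueness; measures are compared on Borel sets *)
    (even_measure mu /\ represents mu G /\
     (forall nu : {finite_measure set R -> \bar R},
        even_measure nu -> represents nu G ->
        forall B : set R, measurable B -> nu B = mu B)) /\
    (* (i) *)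
    weak_cvg mu_ mu /\
    (* (ii) *)
    (forall B : set R, measurable B -> mu (boundary B) = 0%E ->
       mu_ k B @[k --> \oo] --> mu B) /\
    (* (iii) *)
    (mu.-integrable setT (fun u : R => (u ^+ 2)%:E) /\
     (\int[mu_ k]_u (u ^+ 2) @[k --> \oo] --> \int[mu]_u (u ^+ 2)) /\
     (forall z : R[i], derivable G z 1) /\
     derivable G^`() 0 1 /\
     (\int[mu]_u (u ^+ 2))%:C = - (G^`(2))%classic 0) /\
    (* (iv) *)
    (ereal_sup (range (fun k : nat =>
       (\int[mu_ k]_(u in [set u : R | (A < `|u|)%R]) (u ^+ 2)%:E)%E))
       @[A --> +oo%R] --> 0%E) /\
    (* (v) *)
    (forall h : R -> R[i], continuous h ->
       (exists C : R, forall u : R, `|h u| <= (C * (1 + u ^+ 2))%:C) ->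
       (forall k : nat, cintegrable (mu_ k) h) /\ cintegrable mu h /\
       cintegral (mu_ k) h @[k --> \oo] --> cintegral mu h) /\
    (* (vi) *)
    (ereal_sup (range (fun k : nat => mu_ k [set u : R | (A < `|u|)%R]))
       @[A --> +oo%R] --> 0%E) /\
    (* exponential moments *)
    (forall r : R, 0 < r -> (\int[mu]_u (expR (r * `|u|))%:E < +oo)%E).
Proof.
(* Uniform convergence on the compact set [[set z]] is convergence at [z]. *)
have gG z : transform (mu_ k) 0 z @[k --> \oo] --> G z.
  have : fourier_laplace (mu_ k) z @[k --> \oo] --> G z.
    by have := cvgG [set z] (@compact_set1 _ z); rewrite uniform_set1.
  by under eq_fun do rewrite fourier_laplaceE.
have mu_int k : exp_integrable (mu_ k) := compactly_supported_exp_integrable (mu_csupp k).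
have wG r : cvgn (fun k => wave_integral (mu_ k) 0 0 r 0).
  by have /cvg_complexP[+ _] := gG (0 +i* r); move=> h; apply/cvg_ex; eexists; exact: h.
have mu_bnd : exp_bounded mu_.
  move=> r.
  have [M [_ HM]] := cvg_seq_bounded (is_cvgD (wG (- r)) (wG r)).
  exists (M + 1) => k.
  apply: (@le_trans _ _
    (wave_integral (mu_ k) 0 0 (- r) 0 + wave_integral (mu_ k) 0 0 r 0)); last first.
    by apply: (le_trans (ler_norm _)); apply: (HM (M + 1)) => //; rewrite ltrDl.
  rewrite /wave_integral -RintegralD//; try exact: wave_integrable.
  apply: le_Rintegral => //; first exact: mu_int.
    have := integrableD measurableT (wave_integrable 0 0 (- r) 0 (mu_int k))
      (wave_integrable 0 0 r 0 (mu_int k)).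
    exact: eq_integrable.
  by move=> u _; exact: expR_norm_le_wave.
have mu_cos t s : cvgn (fun k => \int[mu_ k]_u cos (t * u + s)).
  under eq_fun do rewrite Rintegral_cosE//.
  have /cvg_complexP[hR hI] := gG (t +i* 0).
  apply: is_cvgB; apply: is_cvgM; try exact: is_cvg_cst.
    by apply/cvg_ex; eexists; exact: hR.
  by apply/cvg_ex; eexists; exact: hI.
have [mu mu_w] := ex_weak_limit mu_int mu_bnd
  (is_cvg_Rintegral_bounded_continuous mu_int mu_bnd mu_cos).
have mui : exp_integrable mu := exp_integrable_limit mu_int mu_bnd mu_w.
have cvg_growth := cvg_Rintegral_exp_growth mu_int mu_bnd mu_w.
have GE z : G z = transform mu 0 z.
  apply: (cvg_unique _ (gG z)) => //.
  have cw phi := cvg_growth _ 1 (0%:R + `|complex.Im z|) (addr_ge0 (ler0n _ 0) (normr_ge0 _))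
    (@continuous_wave _ 0 (complex.Re z) (complex.Im z) phi)
    (wave_bound 0 (complex.Re z) (complex.Im z) phi).
  by apply/cvg_complexP; split => /=; exact: cw.
have muG : represents mu G.
  by move=> z; split; [exact: cintegrable_cexp_kernel|rewrite fourier_laplaceE].
have sqr_le u : `|u ^+ 2| <= 1 * expR (2 * `|u|) :> R by rewrite mul1r normrX_le_expR.
have csqr : continuous (fun u : R => u ^+ 2) by exact: exprn_continuous.
have isqr m : exp_integrable m -> m.-integrable setT (fun u : R => (u ^+ 2)%:E).
  move=> mi; apply: (@integrable_le_continuous _ m _ (fun u => expR (2 * `|u|))) => //.
  by move=> u; have := sqr_le u; rewrite mul1r.
have iE : (0 +i* 1) * (0 +i* 1) = -1 :> R[i].
  by apply/eqP; rewrite eq_complex /=; apply/andP; split; apply/eqP; ring.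
(* Derivatives of [G] are taken from its representation by [mu], with [c = 1] here and [c = i] for
   the second one. *)
have dG (z : R[i]) : is_derive z 1 G ((0 +i* 1) * transform mu 1 z).
  have -> : G = (fun z => 1 * transform mu 0 z) by apply/funext => w; rewrite GE mul1r.
  by rewrite -[X in is_derive _ _ _ X]mul1r; exact: is_derive_transform.
have G'E : G^`()%classic = (fun z => (0 +i* 1) * transform mu 1 z).
  by apply/funext => z; rewrite derive1E; apply: derive_val.
have dG' : is_derive (0 : R[i]) 1 G^`()%classic ((0 +i* 1) * ((0 +i* 1) * transform mu 2 0)).
  by rewrite G'E; exact: is_derive_transform.
exists mu; split; [|split; [|split; [|split; [|split; [|split; [|split]]]]]].
- split; first exact: weak_limit_even mu_w mu_even.
  by split=> // nu _ nuG; exact: represents_unique nuG muG.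
- move=> f cf [M [_ HM]]; apply: mu_w; split => //.
  by exists (M + 1) => u; apply: HM => //; rewrite ltrDl.
- by move=> B mB B0; exact: weak_cvg_continuity_set mu_w _ mB B0.
- split; first exact: isqr.
  split; first exact: cvg_growth csqr sqr_le.
  split; first by move=> z; exact: (@ex_derive _ _ _ _ _ _ _ (dG z)).
  split; first exact: (@ex_derive _ _ _ _ _ _ _ dG').
  rewrite /derive1n /= derive1E (derive_val (is_derive := dG')) mulrA iE mulN1r opprK.
  apply/eqP; rewrite eq_complex /transform /wave_integral /=; apply/andP; split; apply/eqP.
    apply: eq_Rintegral => u _; rewrite /wave !mul0r oppr0 expR0 addr0 cos0; ring.
  (* At [z = 0] the imaginary wave has constant phase [- pi / 2], where the cosine vanishes; 0 is
     rewritten as an integral to compare integrands. *)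
  rewrite -[LHS](mul0r (fine (mu setT))) -Rintegral_cst//.
  apply: eq_Rintegral => u _.
  by rewrite /wave !mul0r add0r mulNr cosN cos_pihalf; ring.
(* The exponent 3 comes from [u ^+ 2 * A <= |u| ^+ 3 <= expR (3 * |u|)] on the tail. *)
- have [K KP] := mu_bnd 3.
  have K0 : 0 <= K by apply: le_trans (KP 0%N); apply: Rintegral_ge0 => u _; exact: expR_ge0.
  apply: (cvg_ereal_sup_tail K0) => [k A|k A A0].
    by apply: integral_ge0 => u _; rewrite lee_fin sqr_ge0.
  have sqr0 u : 0 <= u ^+ 2 :> R by exact: sqr_ge0.
  have sqrA u : A < `|u| -> u ^+ 2 * A <= expR (3 * `|u|).
    move=> Au; apply: le_trans (normrX_le_expR 3 u).
    by rewrite normrX [leRHS]exprSr real_normK ?num_real// ler_wpM2l// ltW.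
  apply: (le_trans (integral_tail_le (mu_int k) csqr A0 sqr0 sqrA)).
  by rewrite lee_fin ler_wpM2l// invr_ge0 ltW.
- move=> h ch [C hC].
  have C0 : 0 <= C.
    have := hC 0; rewrite expr0n addr0 mulr1 => /(le_trans (normr_ge0 _)).
    by rewrite lecR.
  have le2 u : C * (1 + u ^+ 2) <= 2 * C * expR (2 * `|u|).
    have h1 := sqr_le u; rewrite ger0_norm ?sqr_ge0// mul1r in h1.
    have h2 : 1 <= expR (2 * `|u|) by rewrite -expR0 ler_expR mulr_ge0.
    by rewrite [2 * C]mulrC -mulrA ler_wpM2l//; lra.
  have cR : continuous (fun u => complex.Re (h u)).
    by move=> u; have /cvg_complexP[] := ch u.
  have cI : continuous (fun u => complex.Im (h u)).
    by move=> u; have /cvg_complexP[] := ch u.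
  have hR u : `|complex.Re (h u)| <= 2 * C * expR (2 * `|u|).
    by apply: le_trans (le2 u); rewrite -lecR (le_trans (normc_ge_Re _)).
  have hI u : `|complex.Im (h u)| <= 2 * C * expR (2 * `|u|).
    by apply: le_trans (le2 u); rewrite -lecR (le_trans (normc_ge_Im _)).
  split; first by move=> k; split; exact: compactly_supported_integrable.
  have iw : mu.-integrable setT (EFin \o (fun u => 2 * C * expR (2 * `|u|))).
    by have := integrableZl measurableT (2 * C) (mui 2); apply: eq_integrable.
  split; first by split; exact: integrable_le_continuous iw _.
  by apply/cvg_complexP; split; [exact: cvg_growth cR hR|exact: cvg_growth cI hI].
- have [K KP] := mu_bnd 1.
  have K0 : 0 <= K by apply: le_trans (KP 0%N); apply: Rintegral_ge0 => u _; exact: expR_ge0.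
  apply: (cvg_ereal_sup_tail K0) => [k A|k A A0]; first exact: measure_ge0.
  have oneA (u : R) : A < `|u| -> 1 * A <= expR (1 * `|u|).
    move=> Au; rewrite !mul1r; exact: le_trans (ltW Au) (ler_norm_expR u).
  have c1 : continuous (fun _ : R => 1 : R) by exact: cst_continuous.
  have := integral_tail_le (mu_int k) c1 A0 (fun=> ler01) oneA.
  rewrite integral_cst ?mul1e; last exact: measurable_norm_gt.
  move=> /le_trans; apply.
  by rewrite lee_fin ler_wpM2l// invr_ge0 ltW.
- move=> r _; have [K KP] := integral_expR_le mu_int mu_bnd mu_w r.
  exact: le_lt_trans KP (ltry K).
Qed.
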